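(* Let $R$ be a commutative ring. Then there is a morphism of ringed spaces $(\phi,\phi^\#):\mathrm{Spec}(R)\to\mathrm{NCSpec}(R)$ such that $\phi$ is a homeomorphism of $\mathrm{Spec}(R)$ with a dense subspace of $\mathrm{NCSpec}(R)\setminus\{\gamma\}$, where $\gamma$ is the generic point of $\mathrm{NCSpec}(R)$, and such that $\phi^\#:\mathcal O_{\mathrm{NCSpec}(R)}\to\phi_*\mathcal O_{\mathrm{Spec}(R)}$ is an isomorphism of sheaves on $\mathrm{NCSpec}(R)$.
   Context: Rings are unital, the zero ring (with $1=0$) is allowed, and ring homomorphisms preserve identity elements. A ringed space is a topological space with a sheaf of rings; a morphism $(X,\mathcal O_X)\to(Y,\mathcal O_Y)$ is a pair $(\phi,\phi^\#)$ with $\phi:X\to Y$ continuous and $\phi^\#:\mathcal O_Y\to\phi_*\mathcal O_X$ a morphism of sheaves of rings. $\mathrm{Spec}(R)$ is the usual prime spectrum with its structure sheaf. Localization: for a subset $A$ of a ring $R$, $\alpha_A:R\to loc(R,A)$ denotes the universal ring homomorphism sending every element of $A$ to a unit: any ring homomorphism $R\to T$ (with $T$ not necessarily commutative) sending every $a\in A$ to a unit factors uniquely through $\alpha_A$. Write $A\preceq B$ if $\alpha_B(a)$ is a unit in $loc(R,B)$ for all $a\in A$; then $p_{BA}:loc(R,A)\to loc(R,B)$ is the unique homomorphism with $p_{BA}\alpha_A=\alpha_B$. The relation $\preceq$ is a preorder on the set $L_0(R)$ of finite subsets of $R$; $L(R)$ is the poset of equivalence classes for $A\sim B\iff A\preceq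 B\preceq A$, and $R_A$ denotes the class of $A$, so $R_A\le R_B\iff A\preceq B$. The space $\mathrm{NCSpec}(R)$: give $L(R)$ the Alexandrov topology (open sets are the upper sets), with base $U_E=\{R_F:R_F\ge R_E\}$, and the unique sheaf of rings $\mathcal O$ with $\mathcal O(U_E)=loc(R,E)$ and restriction maps $p_{FE}$ for $U_F\subset U_E$. For a topological space $X$, its soberification $S(X)$ is the set of irreducible (in particular nonempty) closed subsets of $X$ with open sets $\widetilde U=\{C\in S(X):C\cap U\ne\varnothing\}$, $U$ open in $X$; $U\mapsto\widetilde U$ is an isomorphism of lattices of open sets. $\mathrm{NCSpec}(R)$ is $S(L(R))$ with the sheaf $\mathcal O(\widetilde U):=\mathcal O(U)$. The space $L(R)$ is itself irreducible; the generic point $\gamma$ of $\mathrm{NCSpec}(R)$ is the point $\gamma=L(R)\in S(L(R))$. *)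

(* Defs.v *)
From HB Require Import structures.
From mathcomp Require Import all_boot all_order all_algebra finmap.
From mathcomp Require Import mathcomp_extra boolp classical_sets functions.
From mathcomp Require Import topology.
From mathcomp Require Import ring.

Set Implicit Arguments.
Unset Strict Implicit.
Unset Printing Implicit Defensive.

Import Order.TTheory GRing.Theory.

Local Open Scope classical_set_scope.
Local Open Scope ring_scope.
Local Open Scope quotient_scope.

(* Rings are [pzRingType]: unital, not necessarily commutative, and possibly
   zero.  The [choiceType] structure this carries is no restriction: the
   axioms of [boolp] provide one on every type. *)

Definition is_unit (T : pzRingType) (x : T) : Prop :=
  exists y, y * x = 1 /\ x * y = 1.

Lemma is_unit_rmorph (S T : pzRingType) (f : {rmorphism S -> T}) x :
  is_unit x -> is_unit (f x).
Proof.
by move=> [y [yx xy]]; exists (f y); rewrite -!rmorphM yx xy rmorph1.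
Qed.

Record opens (X : topologicalType) := Opens {
  oset :> set X;
  oset_open : open oset
}.

Definition opensI (X : topologicalType) (U V : opens X) : opens X :=
  Opens (openI (oset_open U) (oset_open V)).

Lemma open_preimage (X Y : topologicalType) (f : X -> Y) (cf : continuous f)
  (U : opens Y) : open (f @^-1` U).
Proof. by have /continuousP := cf; apply; exact: oset_open. Qed.

Definition opens_preimage (X Y : topologicalType) (f : X -> Y)
  (cf : continuous f) (U : opens Y) : opens X := Opens (open_preimage cf U).

Record presheaf (X : topologicalType) := Presheaf {
  sections :> opens X -> pzRingType;
  restr : forall U V : opens X, V `<=` U ->
    {rmorphism sections U -> sections V};
  restr_id : forall (U : opens X) (UU : U `<=` U) s, restr UU s = s;
  restr_comp : forall (U V W : opens X) (VU : V `<=` U) (WV : W `<=` V)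
    (WU : W `<=` U) s, restr WV (restr VU s) = restr WU s
}.
Arguments restr {X} F {U V} VU : rename.

Definition is_sheaf (X : topologicalType) (F : presheaf X) : Prop :=
  forall (I : Type) (U : I -> opens X) (W : opens X)
    (WE : W = \bigcup_i U i :> set X) (UW : forall i, U i `<=` W),
  (forall s t : F W,
    (forall i, restr F (UW i) s = restr F (UW i) t) -> s = t) /\
  (forall s : forall i, F (U i),
    (forall i j,
      restr F (V := opensI (U i) (U j)) (@subIsetl _ (U i) (U j)) (s i) =
      restr F (V := opensI (U i) (U j)) (@subIsetr _ (U i) (U j)) (s j)) ->
    exists t : F W, forall i, restr F (UW i) t = s i).

Record sheaf (X : topologicalType) := Sheaf {
  sheaf_presheaf :> presheaf X;
  sheafP : is_sheaf sheaf_presheaf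
}.

Record sheaf_hom (X : topologicalType) (F G : presheaf X) := SheafHom {
  hom_at :> forall U : opens X, {rmorphism F U -> G U};
  hom_restr : forall (U V : opens X) (VU : V `<=` U) (s : F U),
    hom_at V (restr F VU s) = restr G VU (hom_at U s)
}.

Definition is_sheaf_iso (X : topologicalType) (F G : presheaf X)
    (f : sheaf_hom F G) : Prop :=
  exists g : sheaf_hom G F,
    (forall U, cancel (f U) (g U)) /\ (forall U, cancel (g U) (f U)).

Section Pushforward.
Variables (X Y : topologicalType) (f : X -> Y) (cf : continuous f).
Variable F : sheaf X.

Definition pushforward_presheaf : presheaf Y :=
  @Presheaf Y (fun U => F (opens_preimage cf U))
    (fun U V VU => restr F (U := opens_preimage cf U) (V := opens_preimage cf V)
      (fun x => VU (f x)))
    (fun U UU s => restr_id (p := F) _ s)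
    (fun U V W VU WV WU s => restr_comp (p := F) _ _ _ s).

Lemma pushforward_is_sheaf : is_sheaf pushforward_presheaf.
Proof.
move=> I U W WE UW.
have WE' : opens_preimage cf W
    = \bigcup_i (opens_preimage cf (U i)) :> set X.
  by rewrite /= WE preimage_bigcup.
have [sep glue] := sheafP F WE' (fun i x => UW i (f x)).
split=> [s t st|s sc]; first exact: sep.
apply: glue => i j; have /= E := sc i j.
pose V := opens_preimage cf (opensI (U i) (U j)).
have VV : opensI (opens_preimage cf (U i)) (opens_preimage cf (U j)) `<=` V.
  by [].
apply: etrans (etrans (congr1 (restr F VV) E) _); last exact: restr_comp.
exact/esym/restr_comp.
Qed.

Definition pushforward : sheaf Y := Sheaf pushforward_is_sheaf.

End Pushforward.

Record ringed_space := RingedSpace {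
  rs_space :> topologicalType;
  rs_sheaf : sheaf rs_space
}.

Record rs_morphism (X Y : ringed_space) := RSMorphism {
  rs_map :> X -> Y;
  rs_continuous : continuous rs_map;
  rs_comorphism :
    sheaf_hom (rs_sheaf Y) (pushforward rs_continuous (rs_sheaf X))
}.

Definition is_homeomorphism (X Y : topologicalType) (f : X -> Y) : Prop :=
  continuous f /\
  exists g : Y -> X, [/\ continuous g, cancel f g & cancel g f].

Definition dprod (J : Type) (F : J -> pzRingType) : Type := forall j, F j.

Section DProd.
Variables (J : Type) (F : J -> pzRingType).
HB.instance Definition _ := gen_eqMixin (dprod F).
HB.instance Definition _ := gen_choiceMixin (dprod F).

Let zero : dprod F := fun=> 0.
Let opp (s : dprod F) : dprod F := fun j => - s j.
Let add (s t : dprod F) : dprod F := fun j => s j + t j.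
Let one : dprod F := fun=> 1.
Let mul (s t : dprod F) : dprod F := fun j => s j * t j.

Let ext (s t : dprod F) : (forall j, s j = t j) -> s = t.
Proof. exact: functional_extensionality_dep. Qed.
Let paddA : associative add.
Proof. by move=> *; apply: ext => j; exact: addrA. Qed.
Let paddC : commutative add.
Proof. by move=> *; apply: ext => j; exact: addrC. Qed.
Let padd0 : left_id zero add.
Proof. by move=> *; apply: ext => j; exact: add0r. Qed.
Let paddN : left_inverse zero opp add.
Proof. by move=> *; apply: ext => j; exact: addNr. Qed.
Let pmulA : associative mul.
Proof. by move=> *; apply: ext => j; exact: mulrA. Qed.
Let pmul1 : left_id one mul.
Proof. by move=> *; apply: ext => j; exact: mul1r. Qed.
Let pmulI : right_id one mul.
Proof. by move=> *; apply: ext => j; exact: mulr1. Qed.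
Let pmulDl : left_distributive mul add.
Proof. by move=> *; apply: ext => j; exact: mulrDl. Qed.
Let pmulDr : right_distributive mul add.
Proof. by move=> *; apply: ext => j; exact: mulrDr. Qed.

HB.instance Definition _ := GRing.isPzRing.Build (dprod F)
  paddA paddC padd0 paddN pmulA pmul1 pmulI pmulDl pmulDr.
End DProd.

(* The common shape of the structure sheaves below: a section over [U] is a
   family of elements of the rings [fd_fiber j], for all indices [j] lying
   over [U], subject to a condition that can be checked locally on [U]. *)
Definition families (X : topologicalType) (J : Type) (b : J -> X)
    (F : J -> pzRingType) (U : set X) : pzRingType :=
  dprod (fun j : {j : J | U (b j)} => F (sval j)).

Definition family_restr (X : topologicalType) (J : Type) (b : J -> X)
    (F : J -> pzRingType) (U V : set X) (VU : V `<=` U) (s : families b F U) :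
    families b F V :=
  fun j => s (exist _ (sval j) (VU _ (svalP j))).

Record family_data (X : topologicalType) := FamilyData {
  fd_index : Type;
  fd_base : fd_index -> X;
  fd_fiber : fd_index -> pzRingType;
  fd_cond : forall U : opens X, families fd_base fd_fiber U -> Prop;
  fd_cond1 : forall (U : opens X), fd_cond (1 : families fd_base fd_fiber U);
  fd_condB : forall (U : opens X) (s t : families fd_base fd_fiber U),
    fd_cond s -> fd_cond t -> fd_cond (s - t);
  fd_condM : forall (U : opens X) (s t : families fd_base fd_fiber U),
    fd_cond s -> fd_cond t -> fd_cond (s * t);
  fd_cond_restr : forall (U V : opens X) (VU : V `<=` U)
    (s : families fd_base fd_fiber U), fd_cond s ->
    fd_cond (U := V) (family_restr VU s);
  fd_cond_local : forall (U : opens X) (s : families fd_base fd_fiber U),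
    (forall x, oset U x -> exists (V : opens X) (VU : V `<=` U),
      oset V x /\ fd_cond (U := V) (family_restr VU s)) ->
    fd_cond s
}.

Arguments fd_base {X} f j : rename.
Arguments fd_fiber {X} f j : rename.

Section FamilySheaf.
Variables (X : topologicalType) (D : family_data X).

Record family_section (U : opens X) := FamilySection {
  fam_val :> families (fd_base D) (fd_fiber D) U;
  fam_cond : `[< fd_cond fam_val >]
}.

Section Ring.
Variable U : opens X.

HB.instance Definition _ := [isSub for @fam_val U].
HB.instance Definition _ := [Choice of family_section U by <:].

Let cond_closed : subring_closed
  (fun s : families (fd_base D) (fd_fiber D) U => `[< fd_cond s >]).
Proof.
split=> [|s t /asboolP hs /asboolP ht|s t /asboolP hs /asboolP ht];
  apply/asboolP; [exact: fd_cond1|exact: fd_condB|exact: fd_condM].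
Qed.

HB.instance Definition _ :=
  GRing.SubChoice_isSubPzRing.Build _ _ (family_section U) cond_closed.
End Ring.

Lemma family_section_ext (U : opens X) (s t : family_section U) :
  (forall j, fam_val s j = fam_val t j) -> s = t.
Proof. by move=> st; apply/val_inj/functional_extensionality_dep. Qed.

Section Restr.
Variables (U V : opens X) (VU : V `<=` U).

Definition family_section_restr (s : family_section U) : family_section V :=
  FamilySection (asboolT (fd_cond_restr VU (asboolW (fam_cond s)))).

Let restrB : zmod_morphism family_section_restr.
Proof. by move=> s t; exact: family_section_ext. Qed.
Let restrM : monoid_morphism family_section_restr.
Proof. by split=> [|s t]; exact: family_section_ext. Qed.

HB.instance Definition _ :=
  GRing.isZmodMorphism.Build _ _ family_section_restr restrB.
HB.instance Definition _ :=
  GRing.isMonoidMorphism.Build _ _ family_section_restr restrM.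
End Restr.

Definition family_presheaf : presheaf X.
Proof.
apply: (@Presheaf X family_section
  (fun U V VU => family_section_restr VU : {rmorphism _ -> _})).
- move=> U UU s; apply: family_section_ext => -[j Uj] /=.
  by rewrite /family_restr /=; congr (fam_val s (exist _ _ _)).
- move=> U V W VU WV WU s; apply: family_section_ext => -[j Uj] /=.
  by rewrite /family_restr /=; congr (fam_val s (exist _ _ _)).
Defined.

Lemma family_is_sheaf : is_sheaf family_presheaf.
Proof.
move=> I U W WE UW; split=> [s t st|s sc].
  apply: family_section_ext => -[j Wj].
  have [i _ Uij] : (\bigcup_i U i) (fd_base D j) by rewrite -WE.
  have := congr1 (fun r => fam_val r (exist _ j Uij)) (st i).
  rewrite /= /family_restr /=.
  by congr (fam_val s (exist _ _ _) = fam_val t (exist _ _ _)).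
have pick (j : {j | oset W (fd_base D j)}) :
    {i : I | oset (U i) (fd_base D (sval j))}.
  by apply: cid; case: j => j /=; rewrite WE => -[i _ ?]; exists i.
pose t : families (fd_base D) (fd_fiber D) W :=
  fun j => fam_val (s (sval (pick j))) (exist _ (sval j) (svalP (pick j))).
have tE i : family_restr (UW i) t = fam_val (s i).
  apply: functional_extensionality_dep => -[j Uij].
  rewrite /family_restr /t /=; set k := pick _.
  pose j' : {j | oset (opensI (U (sval k)) (U i)) (fd_base D j)} :=
    exist _ j (conj (svalP k) Uij).
  have := congr1
    (fun r : family_section (opensI (U (sval k)) (U i)) => fam_val r j')
    (sc (sval k) i).
  rewrite /= /family_restr /= => E; apply: etrans (etrans E _).
    by congr (fam_val (s (sval k)) (exist _ _ _)).
  by congr (fam_val (s i) (exist _ _ _)).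
have tP : fd_cond t.
  apply: fd_cond_local => x Wx.
  have [i _ Uix] : (\bigcup_i U i) x by rewrite -WE.
  by exists (U i), (UW i); split => //; rewrite tE; exact: asboolW (fam_cond _).
exists (FamilySection (asboolT tP)) => i.
by apply/val_inj; rewrite /= tE.
Qed.

Definition family_sheaf : sheaf X := Sheaf family_is_sheaf.

End FamilySheaf.

Section Localization.
Variables (R : pzRingType) (A : set R).

(* [loc A] is presented by generators and relations: the ring generated by a
   copy of [R] together with a formal two-sided inverse of each [a] in [A]. *)
Inductive loc_term : Type :=
| LConst of R
| LInv (a : R) of A a
| LOpp of loc_term
| LAdd of loc_term & loc_term
| LMul of loc_term & loc_term.

Inductive loc_eq : loc_term -> loc_term -> Prop :=
| loc_refl x : loc_eq x x
| loc_sym x y : loc_eq x y -> loc_eq y x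
| loc_trans x y z : loc_eq x y -> loc_eq y z -> loc_eq x z
| loc_opp x x' : loc_eq x x' -> loc_eq (LOpp x) (LOpp x')
| loc_add x x' y y' :
    loc_eq x x' -> loc_eq y y' -> loc_eq (LAdd x y) (LAdd x' y')
| loc_mul x x' y y' :
    loc_eq x x' -> loc_eq y y' -> loc_eq (LMul x y) (LMul x' y')
| loc_addA x y z : loc_eq (LAdd x (LAdd y z)) (LAdd (LAdd x y) z)
| loc_addC x y : loc_eq (LAdd x y) (LAdd y x)
| loc_add0 x : loc_eq (LAdd (LConst 0) x) x
| loc_addN x : loc_eq (LAdd (LOpp x) x) (LConst 0)
| loc_mulA x y z : loc_eq (LMul x (LMul y z)) (LMul (LMul x y) z)
| loc_mul1l x : loc_eq (LMul (LConst 1) x) x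
| loc_mul1r x : loc_eq (LMul x (LConst 1)) x
| loc_mulDl x y z : loc_eq (LMul (LAdd x y) z) (LAdd (LMul x z) (LMul y z))
| loc_mulDr x y z : loc_eq (LMul x (LAdd y z)) (LAdd (LMul x y) (LMul x z))
| loc_constD r s : loc_eq (LConst (r + s)) (LAdd (LConst r) (LConst s))
| loc_constM r s : loc_eq (LConst (r * s)) (LMul (LConst r) (LConst s))
| loc_invl a (Aa : A a) : loc_eq (LMul (LInv Aa) (LConst a)) (LConst 1)
| loc_invr a (Aa : A a) : loc_eq (LMul (LConst a) (LInv Aa)) (LConst 1).

HB.instance Definition _ := gen_eqMixin loc_term.
HB.instance Definition _ := gen_choiceMixin loc_term.

Definition loc_eqb (x y : loc_term) : bool := `[< loc_eq x y >].

Let loc_eqb_refl : reflexive loc_eqb.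
Proof. by move=> x; apply/asboolP; exact: loc_refl. Qed.
Let loc_eqb_sym : symmetric loc_eqb.
Proof. by move=> x y; apply/asboolP/asboolP; exact: loc_sym. Qed.
Let loc_eqb_trans : transitive loc_eqb.
Proof.
by move=> y x z /asboolP xy /asboolP yz; apply/asboolP; exact: loc_trans yz.
Qed.
Canonical loc_equiv := EquivRel loc_eqb loc_eqb_refl loc_eqb_sym loc_eqb_trans.

Definition loc : Type := {eq_quot loc_equiv}.
HB.instance Definition _ := Choice.on loc.
HB.instance Definition _ := EqQuotient.on loc.

Lemma loc_piP (x y : loc_term) : \pi_loc x = \pi_loc y <-> loc_eq x y.
Proof.
split=> [/eqP|xy]; first by rewrite eqmodE => /asboolP.
by apply/eqP; rewrite eqmodE; apply/asboolP.
Qed.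

Let zero : loc := \pi_loc (LConst 0).
Let one : loc := \pi_loc (LConst 1).
Let opp (x : loc) : loc := \pi_loc (LOpp (repr x)).
Let add (x y : loc) : loc := \pi_loc (LAdd (repr x) (repr y)).
Let mul (x y : loc) : loc := \pi_loc (LMul (repr x) (repr y)).

Let reprE x : loc_eq (repr (\pi_loc x)) x.
Proof. by apply/loc_piP; rewrite reprK. Qed.
Let oppE x : opp (\pi_loc x) = \pi_loc (LOpp x).
Proof. by apply/loc_piP/loc_opp; exact: reprE. Qed.
Let addE x y : add (\pi_loc x) (\pi_loc y) = \pi_loc (LAdd x y).
Proof. by apply/loc_piP/loc_add; exact: reprE. Qed.
Let mulE x y : mul (\pi_loc x) (\pi_loc y) = \pi_loc (LMul x y).
Proof. by apply/loc_piP/loc_mul; exact: reprE. Qed.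

Let qaddA : associative add.
Proof.
elim/quotW=> x; elim/quotW=> y; elim/quotW=> z.
by rewrite (addE y) (addE x y) 2!addE; apply/loc_piP; exact: loc_addA.
Qed.
Let qaddC : commutative add.
Proof.
by elim/quotW=> x; elim/quotW=> y; rewrite !addE;
  apply/loc_piP; exact: loc_addC.
Qed.
Let qadd0 : left_id zero add.
Proof. by elim/quotW=> x; rewrite !addE; apply/loc_piP; exact: loc_add0. Qed.
Let qaddN : left_inverse zero opp add.
Proof.
by elim/quotW=> x; rewrite oppE addE; apply/loc_piP; exact: loc_addN.
Qed.
Let qmulA : associative mul.
Proof.
elim/quotW=> x; elim/quotW=> y; elim/quotW=> z.
by rewrite (mulE y) (mulE x y) 2!mulE; apply/loc_piP; exact: loc_mulA.
Qed.
Let qmul1l : left_id one mul.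
Proof. by elim/quotW=> x; rewrite !mulE; apply/loc_piP; exact: loc_mul1l. Qed.
Let qmul1r : right_id one mul.
Proof. by elim/quotW=> x; rewrite !mulE; apply/loc_piP; exact: loc_mul1r. Qed.
Let qmulDl : left_distributive mul add.
Proof.
elim/quotW=> x; elim/quotW=> y; elim/quotW=> z.
by rewrite (addE x) (mulE x) (mulE y) mulE addE;
  apply/loc_piP; exact: loc_mulDl.
Qed.
Let qmulDr : right_distributive mul add.
Proof.
elim/quotW=> x; elim/quotW=> y; elim/quotW=> z.
by rewrite (addE y) (mulE x y) (mulE x z) mulE addE;
  apply/loc_piP; exact: loc_mulDr.
Qed.

HB.instance Definition _ := GRing.isPzRing.Build loc
  qaddA qaddC qadd0 qaddN qmulA qmul1l qmul1r qmulDl qmulDr.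

Definition alpha (r : R) : loc := \pi_loc (LConst r).

Let alphaD r s : alpha (r + s) = alpha r + alpha s.
Proof. by rewrite [RHS]addE; apply/loc_piP; exact: loc_constD. Qed.
Let alphaB : zmod_morphism alpha.
Proof. by move=> r s; apply/eqP; rewrite -subr_eq opprK -alphaD subrK. Qed.
Let alphaM : monoid_morphism alpha.
Proof.
by split=> // r s; rewrite [RHS]mulE; apply/loc_piP; exact: loc_constM.
Qed.

HB.instance Definition _ := GRing.isZmodMorphism.Build _ _ alpha alphaB.
HB.instance Definition _ := GRing.isMonoidMorphism.Build _ _ alpha alphaM.

Lemma alpha_unit a : A a -> is_unit (alpha a).
Proof.
move=> Aa; exists (\pi_loc (LInv Aa)); split.
  by rewrite [LHS]mulE; apply/loc_piP; exact: loc_invl.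
by rewrite [LHS]mulE; apply/loc_piP; exact: loc_invr.
Qed.

Theorem loc_universal (T : pzRingType) (g : {rmorphism R -> T}) :
  (forall a, A a -> is_unit (g a)) ->
  exists h : {rmorphism loc -> T}, (forall r, h (alpha r) = g r) /\
    forall h' : {rmorphism loc -> T}, (forall r, h' (alpha r) = g r) -> h' =1 h.
Proof.
move=> gu; pose ginv a (Aa : A a) : T := sval (cid (gu a Aa)).
have ginvP a (Aa : A a) : ginv a Aa * g a = 1 /\ g a * ginv a Aa = 1.
  exact: svalP (cid (gu a Aa)).
pose fix ev (x : loc_term) : T := match x with
  | LConst r => g r
  | LInv a Aa => ginv a Aa
  | LOpp x => - ev x
  | LAdd x y => ev x + ev y
  | LMul x y => ev x * ev y
  end.
have evP x y : loc_eq x y -> ev x = ev y.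
  elim=> {x y} //=.
  - by move=> x y z _ -> _ ->.
  - by move=> x y _ ->.
  - by move=> x x' y y' _ -> _ ->.
  - by move=> x x' y y' _ -> _ ->.
  - by move=> x y z; rewrite addrA.
  - by move=> x y; rewrite addrC.
  - by move=> x; rewrite rmorph0 add0r.
  - by move=> x; rewrite rmorph0 addNr.
  - by move=> x y z; rewrite mulrA.
  - by move=> x; rewrite rmorph1 mul1r.
  - by move=> x; rewrite rmorph1 mulr1.
  - by move=> x y z; rewrite mulrDl.
  - by move=> x y z; rewrite mulrDr.
  - by move=> r s; rewrite rmorphD.
  - by move=> r s; rewrite rmorphM.
  - by move=> a Aa; rewrite rmorph1 (ginvP a Aa).1.
  - by move=> a Aa; rewrite rmorph1 (ginvP a Aa).2.
pose h (x : loc) : T := ev (repr x).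
have hE x : h (\pi_loc x) = ev x by apply/evP/reprE.
have hB : zmod_morphism h.
  elim/quotW=> x; elim/quotW=> y.
  by rewrite [_ - _](_ : _ = \pi_loc (LAdd x (LOpp y))) ?hE // -addE -oppE.
have hM : monoid_morphism h.
  split; first by rewrite (hE (LConst 1)) /= rmorph1.
  elim/quotW=> x; elim/quotW=> y.
  by rewrite [_ * _](_ : _ = \pi_loc (LMul x y)) ?hE // -mulE.
pose mB := GRing.isZmodMorphism.Build _ _ h hB.
pose mM := GRing.isMonoidMorphism.Build _ _ h hM.
pose H : {rmorphism loc -> T} := HB.pack h mB mM.
exists H; split=> [r|h' h'E]; first exact: hE.
have h'E' x : h' (\pi_loc x) = ev x.
  elim: x => [r|a Aa|x IH|x IHx y IHy|x IHx y IHy].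
  - exact: h'E.
  - have inv_l : h' (\pi_loc (LInv Aa)) * g a = 1.
      rewrite -h'E -rmorphM -(rmorph1 h'); congr (h' _).
      by rewrite [LHS]mulE; apply/loc_piP; exact: loc_invl.
    have [_ inv_r] := ginvP a Aa.
    by rewrite -[LHS]mulr1 -inv_r mulrA inv_l mul1r.
  - by rewrite -oppE [LHS]rmorphN IH.
  - by rewrite -addE [LHS]rmorphD IHx IHy.
  - by rewrite -mulE [LHS]rmorphM IHx IHy.
by elim/quotW=> x; rewrite h'E'; exact/esym/hE.
Qed.
End Localization.

Definition preceq (R : pzRingType) (A B : set R) : Prop :=
  forall a, A a -> is_unit (alpha B a).

Definition loc_map (R : pzRingType) (A B : set R) (AB : preceq A B) :
    {rmorphism loc A -> loc B} :=
  sval (cid (loc_universal (g := alpha B) AB)).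

Section LocMap.
Variable R : pzRingType.
Implicit Types A B C : set R.

Lemma loc_mapE A B (AB : preceq A B) r : loc_map AB (alpha A r) = alpha B r.
Proof. by rewrite /loc_map; case: cid => h [hE _] /=. Qed.

Lemma loc_rmorph_ext A (T : pzRingType) (h h' : {rmorphism loc A -> T}) :
  (forall r, h (alpha A r) = h' (alpha A r)) -> h =1 h'.
Proof.
move=> hh'; pose g : {rmorphism R -> T} := (h' \o alpha A : {rmorphism _ -> _}).
have gu a : A a -> is_unit (g a).
  by move=> /alpha_unit/(is_unit_rmorph h').
by have [k [_ kU]] := loc_universal gu; move=> x; rewrite !kU.
Qed.

Lemma preceq_sub A B : A `<=` B -> preceq A B.
Proof. by move=> AB a /AB/alpha_unit. Qed.

Lemma preceq_refl A : preceq A A.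
Proof. exact: preceq_sub. Qed.

Lemma preceq_trans A B C : preceq A B -> preceq B C -> preceq A C.
Proof.
by move=> AB BC a /AB/(is_unit_rmorph (loc_map BC)); rewrite loc_mapE.
Qed.

Lemma loc_map_comp A B C (AB : preceq A B) (BC : preceq B C)
  (AC : preceq A C) x : loc_map BC (loc_map AB x) = loc_map AC x.
Proof.
apply: (@loc_rmorph_ext _ _ (loc_map BC \o loc_map AB : {rmorphism _ -> _})).
by move=> r /=; rewrite !loc_mapE.
Qed.

End LocMap.

Definition alexandrov d (T : porderType d) : Type := T.

Section Alexandrov.
Context d (T : porderType d).
HB.instance Definition _ := Choice.on (alexandrov T).

Definition is_upper (U : set T) : Prop :=
  forall x y, U x -> (x <= y)%O -> U y.

Let upperT : is_upper setT. Proof. by []. Qed.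
Let upperI : setI_closed is_upper.
Proof.
by move=> U V hU hV x y [Ux Vx] xy; split; [exact: hU xy|exact: hV xy].
Qed.
Let upper_bigU (I : Type) (f : I -> set T) :
  (forall i, is_upper (f i)) -> is_upper (\bigcup_i f i).
Proof. by move=> hf x y [i _ fx] xy; exists i => //; exact: hf xy. Qed.

HB.instance Definition _ :=
  isOpenTopological.Build (alexandrov T) upperT upperI upper_bigU.

Lemma open_alexandrov (U : set (alexandrov T)) : open U = is_upper U.
Proof. by []. Qed.

End Alexandrov.

Section Soberification.
Variable X : topologicalType.

Definition irreducible (C : set X) : Prop :=
  C !=set0 /\ forall A B : set X, closed A -> closed B ->
    C `<=` A `|` B -> C `<=` A \/ C `<=` B.

Record soberification := Soberification {
  sob_set :> set X;
  sob_closed : closed sob_set;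
  sob_irr : irreducible sob_set
}.

HB.instance Definition _ := gen_eqMixin soberification.
HB.instance Definition _ := gen_choiceMixin soberification.

Lemma soberification_ext (C D : soberification) : C = D :> set X -> C = D.
Proof.
case: C D => [C cC iC] [D cD iD] /= CD; case: _ / CD cD iD => cD iD.
by congr Soberification; exact: Prop_irrelevance.
Qed.

Definition sob_tilde (U : set X) : set soberification :=
  [set C : soberification | C `&` U !=set0].

Definition sob_open (W : set soberification) : Prop :=
  exists2 U : set X, open U & W = sob_tilde U.

Lemma irreducible_meets (C U V : set X) : irreducible C -> open U -> open V ->
  C `&` U !=set0 -> C `&` V !=set0 -> C `&` (U `&` V) !=set0.
Proof.
move=> [_ irr] oU oV [x [Cx Ux]] [y [Cy Vy]]; apply: contrapT => CUV.
have [] := irr (~` U) (~` V) (open_closedC oU) (open_closedC oV).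
- move=> z Cz; have [Uz|] := pselect (U z); last by left.
  by right=> Vz; apply: CUV; exists z.
- by move=> /(_ x Cx); apply.
- by move=> /(_ y Cy); apply.
Qed.

Let sob_openT : sob_open setT.
Proof.
exists setT; first exact: openT.
apply/esym/seteqP; split=> // C _; rewrite /sob_tilde /= setIT.
by case: (sob_irr C).
Qed.
Let sob_openI : setI_closed sob_open.
Proof.
move=> _ _ [U oU ->] [V oV ->]; exists (U `&` V); first exact: openI.
apply/seteqP; split=> C.
  by move=> [CU CV]; exact: irreducible_meets (sob_irr C) _ _ CU CV.
by move=> [x [Cx [Ux Vx]]]; split; exists x.
Qed.
Let sob_open_bigU (I : Type) (f : I -> set soberification) :
  (forall i, sob_open (f i)) -> sob_open (\bigcup_i f i).
Proof.
move=> /(_ _)/cid2-/all_sig2[U oU fE].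
exists (\bigcup_i U i); first by apply: bigcup_open.
apply/seteqP; split=> C.
  move=> [i _]; rewrite fE => -[x [Cx Ux]]; exists x; split=> //.
  by exists i.
by move=> [x [Cx [i _ Ux]]]; exists i => //; rewrite fE; exists x.
Qed.

HB.instance Definition _ :=
  isOpenTopological.Build soberification sob_openT sob_openI sob_open_bigU.

Lemma closure1_irreducible (x : X) : irreducible (closure [set x]).
Proof.
split; first by exists x; exact: subset_closure.
move=> A B cA cB /(_ x (subset_closure erefl))[Ax|Bx]; [left|right].
- by rewrite ((closure_id A).1 cA); apply: closureS => _ ->.
- by rewrite ((closure_id B).1 cB); apply: closureS => _ ->.
Qed.

Definition sob_eta (x : X) : soberification :=
  Soberification (@closed_closure X [set x]) (closure1_irreducible x).

(* The inverse image along [sob_eta] inverts the lattice isomorphism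
   [sob_tilde]; hence pushing a sheaf [O] on [X] forward along [sob_eta]
   amounts to setting O(U~) := O(U). *)
Lemma sob_eta_tilde (U : set X) : open U -> sob_eta @^-1` sob_tilde U = U.
Proof.
move=> oU; apply/seteqP; split=> x; last first.
  by move=> Ux; exists x; split=> //; exact: subset_closure.
by move=> [y [/(_ U (open_nbhs_nbhs (conj oU _))) + Uy]] => /(_ Uy) [_ [-> ]].
Qed.

Lemma sob_eta_continuous : continuous sob_eta.
Proof. by apply/continuousP => _ [U oU ->]; rewrite sob_eta_tilde. Qed.

End Soberification.

Definition sober_ringed_space (X : ringed_space) : ringed_space :=
  @RingedSpace (soberification X)
    (pushforward (@sob_eta_continuous X) (rs_sheaf X)).

Section NCSpec.
Variable R : pzRingType.

Definition preceqb (A B : {fset R}) : bool := `[< preceq [set` A] [set` B] >].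
Definition simb (A B : {fset R}) : bool := preceqb A B && preceqb B A.

Let preceqb_refl A : preceqb A A.
Proof. by apply/asboolP; exact: preceq_refl. Qed.
Let preceqb_trans : transitive preceqb.
Proof.
by move=> B A C /asboolP AB /asboolP BC; apply/asboolP; exact: preceq_trans BC.
Qed.

Let simb_refl : reflexive simb.
Proof. by move=> A; rewrite /simb preceqb_refl. Qed.
Let simb_sym : symmetric simb.
Proof. by move=> A B; rewrite /simb andbC. Qed.
Let simb_trans : transitive simb.
Proof.
move=> B A C /andP[AB BA] /andP[BC CB].
by rewrite /simb (preceqb_trans AB BC) (preceqb_trans CB BA).
Qed.
Canonical sim_equiv := EquivRel simb simb_refl simb_sym simb_trans.

Definition locposet : Type := {eq_quot sim_equiv}.
HB.instance Definition _ := Choice.on locposet.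
HB.instance Definition _ := EqQuotient.on locposet.

Definition locclass (A : {fset R}) : locposet := \pi_locposet A.

Definition locposet_le (x y : locposet) : bool := preceqb (repr x) (repr y).

Lemma locclass_eq A B : (locclass A == locclass B) = simb A B.
Proof. by rewrite eqmodE. Qed.

Let sim_repr A : simb (repr (locclass A)) A.
Proof. by rewrite -locclass_eq /locclass reprK. Qed.

Let locposet_leE A B : locposet_le (locclass A) (locclass B) = preceqb A B.
Proof.
rewrite /locposet_le.
have /andP[A1 A2] := sim_repr A; have /andP[B1 B2] := sim_repr B.
apply/idP/idP => AB.
  by apply: preceqb_trans B1; apply: preceqb_trans AB.
by apply: preceqb_trans B2; apply: preceqb_trans AB.
Qed.

Let le_refl : reflexive locposet_le.
Proof. by move=> x; exact: preceqb_refl. Qed.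
Let le_anti : antisymmetric locposet_le.
Proof.
elim/quotW=> A; elim/quotW=> B; rewrite !locposet_leE => AB.
by apply/eqP; rewrite locclass_eq.
Qed.
Let le_trans : transitive locposet_le.
Proof. by move=> x y z; exact: preceqb_trans. Qed.

HB.instance Definition _ := Order.isPOrder.Build Order.default_display locposet
  (fun _ _ => erefl) le_refl le_anti le_trans.

Lemma locclass_le A B :
  (locclass A <= locclass B)%O <-> preceq [set` A] [set` B].
Proof.
have -> : (locclass A <= locclass B)%O = preceqb A B by exact: locposet_leE.
by split=> /asboolP.
Qed.

Notation L := (alexandrov locposet).

(* The sections over an upper set [U] are the compatible families in the
   rings [loc E] with [R_E] in [U], i.e. the limit of these rings. *)
Definition loc_compatible (U : opens L)
    (s : families (locclass : _ -> L) (fun E => loc [set` E]) U) : Prop :=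
  forall (E F : {fset R}) (UE : oset U (locclass E)) (UF : oset U (locclass F))
    (EF : preceq [set` E] [set` F]),
  loc_map EF (s (exist _ E UE)) = s (exist _ F UF).

Let compat1 U : loc_compatible (U := U) 1.
Proof. by move=> E F UE UF EF; exact: rmorph1. Qed.
Let compatB U s t : loc_compatible s -> loc_compatible t ->
  loc_compatible (U := U) (s - t).
Proof. by move=> hs ht E F UE UF EF; rewrite rmorphB hs ht. Qed.
Let compatM U s t : loc_compatible s -> loc_compatible t ->
  loc_compatible (U := U) (s * t).
Proof. by move=> hs ht E F UE UF EF; rewrite rmorphM hs ht. Qed.
Let compat_restr (U V : opens L) (VU : V `<=` U) s :
  loc_compatible s -> loc_compatible (U := V) (family_restr VU s).
Proof. by move=> hs E F UE UF EF; exact: hs. Qed.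
Let compat_local (U : opens L)
    (s : families (locclass : _ -> L) (fun E => loc [set` E]) U) :
  (forall x, oset U x -> exists (V : opens L) (VU : V `<=` U),
     oset V x /\ loc_compatible (U := V) (family_restr VU s)) ->
  loc_compatible s.
Proof.
move=> hs E F UE UF EF; have [V [VU [VE hV]]] := hs _ UE.
have VF : oset V (locclass F).
  have := oset_open V; rewrite open_alexandrov; apply; first exact: VE.
  exact/locclass_le.
apply: etrans (etrans _ (hV E F VE VF EF)) _.
  by congr (loc_map EF (s (exist _ _ _))).
by congr (s (exist _ _ _)).
Qed.

Definition loc_family_data : family_data L :=
  FamilyData compat1 compatB compatM compat_restr compat_local.

Definition loc_sheaf : sheaf L := family_sheaf loc_family_data.

Lemma open_basic (E : {fset R}) :
  open ([set x | (locclass E <= x)%O] : set L).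
Proof. by move=> x y /= Ex xy; exact: Order.POrderTheory.le_trans xy. Qed.

Definition basic (E : {fset R}) : opens L := Opens (@open_basic E).

Lemma basic_self (E : {fset R}) : oset (basic E) (locclass E).
Proof. exact: lexx. Qed.

(* Evaluation at [E] identifies O(U_E) with loc(R, E), and the restriction maps
   with the p_FE: see [loc_sheaf_eval_bij] and [loc_sheaf_eval_restr]. *)
Definition loc_sheaf_eval (E : {fset R})
    (s : family_section loc_family_data (basic E)) : loc [set` E] :=
  fam_val s (exist _ E (basic_self E)).

Let evalB E : zmod_morphism (@loc_sheaf_eval E). Proof. by []. Qed.
Let evalM E : monoid_morphism (@loc_sheaf_eval E). Proof. by []. Qed.
HB.instance Definition _ E :=
  GRing.isZmodMorphism.Build _ _ (@loc_sheaf_eval E) (@evalB E).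
HB.instance Definition _ E :=
  GRing.isMonoidMorphism.Build _ _ (@loc_sheaf_eval E) (@evalM E).

Lemma loc_sheaf_eval_bij E : bijective (@loc_sheaf_eval E).
Proof.
pose f (x : loc [set` E]) :
    families (fd_base loc_family_data) (fd_fiber loc_family_data) (basic E) :=
  fun j => loc_map ((locclass_le E (sval j)).1 (svalP j)) x.
have fP x : fd_cond (U := basic E) (f x).
  by move=> F G UF UG FG; exact: loc_map_comp.
exists (fun x => FamilySection (asboolT (fP x))) => [s|x].
  apply: family_section_ext => -[F EF] /=.
  exact: (asboolW (fam_cond s)).
rewrite /loc_sheaf_eval /= /f /=.
by apply: (@loc_rmorph_ext _ _ _ _ idfun) => r; rewrite loc_mapE.
Qed.

Lemma loc_sheaf_eval_restr E F (EF : preceq [set` E] [set` F])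
    (FE : basic F `<=` basic E) (s : loc_sheaf (basic E)) :
  loc_sheaf_eval (restr loc_sheaf FE s) = loc_map EF (loc_sheaf_eval s).
Proof. by apply/esym/(asboolW (fam_cond s)). Qed.

Definition NCSpec : ringed_space :=
  sober_ringed_space (RingedSpace loc_sheaf).

Lemma locposet_irreducible : irreducible [set: L].
Proof.
split; first by exists (locclass fset0).
move=> A B cA cB AB; apply: contrapT => /not_orP[nA nB]; move: nA nB.
move=> /existsNP[x /not_implyP[_]] + /existsNP[y /not_implyP[_]].
elim/quotW: x => E nAE; elim/quotW: y => F nBF.
have := closed_openC cA; have := closed_openC cB.
rewrite !open_alexandrov => uB uA.
have EU : (locclass E <= locclass (E `|` F)%fset)%O.
  by apply/locclass_le/preceq_sub => a /= aE; rewrite inE aE.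
have FU : (locclass F <= locclass (E `|` F)%fset)%O.
  by apply/locclass_le/preceq_sub => a /= aF; rewrite inE aF orbT.
by have [/(uA _ _ nAE EU)|/(uB _ _ nBF FU)] := AB (locclass (E `|` F)%fset) I.
Qed.

Definition NCSpec_generic : NCSpec :=
  Soberification closedT locposet_irreducible.

End NCSpec.

Section Spec.
Variable R : comPzRingType.

Record prime_ideal := PrimeIdeal {
  pideal :> set R;
  pideal0 : pideal 0;
  pidealD : forall a b, pideal a -> pideal b -> pideal (a + b);
  pidealM : forall r a, pideal a -> pideal (r * a);
  pideal1 : ~ pideal 1;
  pideal_prime : forall a b, pideal (a * b) -> pideal a \/ pideal b
}.

HB.instance Definition _ := gen_eqMixin prime_ideal.
HB.instance Definition _ := gen_choiceMixin prime_ideal.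

Definition zeros (A : set R) : set prime_ideal :=
  [set p : prime_ideal | A `<=` p].

Definition zariski_open (U : set prime_ideal) : Prop :=
  exists A : set R, U = ~` zeros A.

Let zariskiT : zariski_open setT.
Proof.
exists setT; apply/esym/seteqP; split=> // p _ pT.
by have := @pideal1 p; apply; exact: pT.
Qed.
Let zariskiI : setI_closed zariski_open.
Proof.
move=> _ _ [A ->] [B ->].
exists [set c | exists a b, [/\ A a, B b & c = a * b]].
rewrite -setCU; congr (~` _); apply/seteqP; split=> p.
  move=> [Ap|Bp] _ [a [b [Aa Bb ->]]]; last by apply: pidealM; exact: Bp.
  by rewrite mulrC; apply: pidealM; exact: Ap.
move=> ABp; apply: contrapT => /not_orP[/existsNP[a /not_implyP[Aa pa]]].
move=> /existsNP[b /not_implyP[Bb pb]].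
by have [] : pideal p a \/ pideal p b
  by apply: pideal_prime; apply: ABp; exists a, b.
Qed.
Let zariski_bigU (J : Type) (f : J -> set prime_ideal) :
  (forall i, zariski_open (f i)) -> zariski_open (\bigcup_i f i).
Proof.
move=> /choice[A fE]; exists (\bigcup_i A i).
rewrite -[LHS]setCK setC_bigcup; congr (~` _); apply/seteqP; split=> p.
  by move=> h a [i _ Aa]; have := h i I; rewrite fE setCK; apply.
by move=> h i _; rewrite fE setCK => a Aa; apply: h; exists i.
Qed.

HB.instance Definition _ :=
  isOpenTopological.Build prime_ideal zariskiT zariskiI zariski_bigU.

Section LocalRing.
Variable p : prime_ideal.

Record fraction := Fraction {
  numer : R;
  denom : R;
  denomP : ~ pideal p denom
}.

HB.instance Definition _ := gen_eqMixin fraction.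
HB.instance Definition _ := gen_choiceMixin fraction.

Definition frac_eq (x y : fraction) : Prop :=
  exists2 u, ~ pideal p u & u * (numer x * denom y - numer y * denom x) = 0.

Definition frac_eqb (x y : fraction) : bool := `[< frac_eq x y >].

Lemma pidealNM a b : ~ pideal p a -> ~ pideal p b -> ~ pideal p (a * b).
Proof. by move=> na nb /pideal_prime[]. Qed.

Let frac_eqb_refl : reflexive frac_eqb.
Proof.
by move=> x; apply/asboolP; exists 1; [exact: pideal1|rewrite subrr mulr0].
Qed.
Let frac_eqb_sym : symmetric frac_eqb.
Proof.
by move=> x y; apply/asboolP/asboolP => -[u pu E]; exists u => //;
  rewrite -opprB mulrN E oppr0.
Qed.
Let frac_eqb_trans : transitive frac_eqb.
Proof.
move=> y x z /asboolP[u pu uE] /asboolP[v pv vE]; apply/asboolP.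
exists (u * v * denom y); first by do !apply: pidealNM => //; exact: denomP.
rewrite [LHS](_ : _ =
    v * denom z * (u * (numer x * denom y - numer y * denom x)) +
    u * denom x * (v * (numer y * denom z - numer z * denom y))); last by ring.
by rewrite uE vE !mulr0 addr0.
Qed.
Canonical frac_equiv :=
  EquivRel frac_eqb frac_eqb_refl frac_eqb_sym frac_eqb_trans.

Definition local_ring : Type := {eq_quot frac_equiv}.
HB.instance Definition _ := Choice.on local_ring.
HB.instance Definition _ := EqQuotient.on local_ring.

Lemma local_ring_piP (x y : fraction) :
  \pi_local_ring x = \pi_local_ring y <-> frac_eq x y.
Proof.
split=> [/eqP|xy]; first by rewrite eqmodE => /asboolP.
by apply/eqP; rewrite eqmodE; apply/asboolP.
Qed.

Definition frac (a f : R) (pf : ~ pideal p f) : local_ring :=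
  \pi_local_ring (Fraction a pf).

Lemma frac_surj (x : local_ring) : exists a f pf, x = @frac a f pf.
Proof. by elim/quotW: x => -[a f pf]; exists a, f, pf. Qed.

Lemma frac_eqP a f (pf : ~ pideal p f) b g (pg : ~ pideal p g) :
  frac a pf = frac b pg <->
  exists2 u, ~ pideal p u & u * (a * g - b * f) = 0.
Proof. exact: local_ring_piP. Qed.

Let repr_numer (x : local_ring) := numer (repr x).
Let repr_denom (x : local_ring) := denom (repr x).
Let repr_denomP (x : local_ring) : ~ pideal p (repr_denom x) :=
  @denomP (repr x).

Let zero : local_ring := frac 0 (@pideal1 p).
Let one : local_ring := frac 1 (@pideal1 p).
Let opp (x : local_ring) : local_ring :=
  frac (- repr_numer x) (@repr_denomP x).
Let add (x y : local_ring) : local_ring :=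
  frac (repr_numer x * repr_denom y + repr_numer y * repr_denom x)
    (pidealNM (@repr_denomP x) (@repr_denomP y)).
Let mul (x y : local_ring) : local_ring :=
  frac (repr_numer x * repr_numer y)
    (pidealNM (@repr_denomP x) (@repr_denomP y)).

Let reprP a f (pf : ~ pideal p f) : exists2 u, ~ pideal p u &
  u * (repr_numer (frac a pf) * f - a * repr_denom (frac a pf)) = 0.
Proof.
have [u pu E] : frac_eq (repr (frac a pf)) (Fraction a pf).
  by apply/local_ring_piP; rewrite reprK.
by exists u.
Qed.

Let oppE a f (pf : ~ pideal p f) : opp (frac a pf) = frac (- a) pf.
Proof.
have [u pu E] := reprP a pf; apply/frac_eqP; exists u => //.
by rewrite -[RHS]oppr0 -E; ring.
Qed.
Let addE a f (pf : ~ pideal p f) b g (pg : ~ pideal p g) :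
  add (frac a pf) (frac b pg) = frac (a * g + b * f) (pidealNM pf pg).
Proof.
have [u pu E] := reprP a pf; have [v pv F] := reprP b pg.
apply/frac_eqP; exists (u * v); first exact: pidealNM.
set x := repr_numer _ in E *; set x' := repr_denom _ in E *.
set y := repr_numer _ in F *; set y' := repr_denom _ in F *.
rewrite [LHS](_ : _ = v * g * y' * (u * (x * f - a * x'))
   + u * f * x' * (v * (y * g - b * y'))); last by ring.
by rewrite E F !mulr0 addr0.
Qed.
Let mulE a f (pf : ~ pideal p f) b g (pg : ~ pideal p g) :
  mul (frac a pf) (frac b pg) = frac (a * b) (pidealNM pf pg).
Proof.
have [u pu E] := reprP a pf; have [v pv F] := reprP b pg.
apply/frac_eqP; exists (u * v); first exact: pidealNM.
set x := repr_numer _ in E *; set x' := repr_denom _ in E *.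
set y := repr_numer _ in F *; set y' := repr_denom _ in F *.
rewrite [LHS](_ : _ = v * y * g * (u * (x * f - a * x'))
   + u * a * x' * (v * (y * g - b * y'))); last by ring.
by rewrite E F !mulr0 addr0.
Qed.

Let frac_same a f (pf : ~ pideal p f) b g (pg : ~ pideal p g) :
  a * g = b * f -> frac a pf = frac b pg.
Proof.
move=> E; apply/frac_eqP; exists 1; first exact: pideal1.
by rewrite E subrr mulr0.
Qed.

Let qaddA : associative add.
Proof.
move=> x y z; have [a [f [pf ->]]] := frac_surj x.
have [b [g [pg ->]]] := frac_surj y; have [c [h [ph ->]]] := frac_surj z.
by rewrite (addE b) (addE a pf b) 2!addE; apply: frac_same; ring.
Qed.
Let qaddC : commutative add.
Proof.
move=> x y; have [a [f [pf ->]]] := frac_surj x.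
have [b [g [pg ->]]] := frac_surj y.
by rewrite 2!addE; apply: frac_same; ring.
Qed.
Let qadd0 : left_id zero add.
Proof.
move=> x; have [a [f [pf ->]]] := frac_surj x.
by rewrite addE; apply: frac_same; ring.
Qed.
Let qaddN : left_inverse zero opp add.
Proof.
move=> x; have [a [f [pf ->]]] := frac_surj x.
by rewrite oppE addE; apply: frac_same; ring.
Qed.
Let qmulA : associative mul.
Proof.
move=> x y z; have [a [f [pf ->]]] := frac_surj x.
have [b [g [pg ->]]] := frac_surj y; have [c [h [ph ->]]] := frac_surj z.
by rewrite (mulE b) (mulE a pf b) 2!mulE; apply: frac_same; ring.
Qed.
Let qmulC : commutative mul.
Proof.
move=> x y; have [a [f [pf ->]]] := frac_surj x.
have [b [g [pg ->]]] := frac_surj y.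
by rewrite 2!mulE; apply: frac_same; ring.
Qed.
Let qmul1l : left_id one mul.
Proof.
move=> x; have [a [f [pf ->]]] := frac_surj x.
by rewrite mulE; apply: frac_same; ring.
Qed.
Let qmul1r : right_id one mul.
Proof. by move=> x; rewrite qmulC. Qed.
Let qmulDl : left_distributive mul add.
Proof.
move=> x y z; have [a [f [pf ->]]] := frac_surj x.
have [b [g [pg ->]]] := frac_surj y; have [c [h [ph ->]]] := frac_surj z.
rewrite (addE a) (mulE a) (mulE b) mulE addE; apply: frac_same; ring.
Qed.
Let qmulDr : right_distributive mul add.
Proof. by move=> x y z; rewrite qmulC qmulDl !(qmulC x). Qed.

HB.instance Definition _ := GRing.isPzRing.Build local_ring
  qaddA qaddC qadd0 qaddN qmulA qmul1l qmul1r qmulDl qmulDr.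
HB.instance Definition _ :=
  GRing.PzRing_hasCommutativeMul.Build local_ring qmulC.

Lemma frac_one : 1 = frac 1 (@pideal1 p). Proof. by []. Qed.
Lemma fracB a f (pf : ~ pideal p f) b g (pg : ~ pideal p g) :
  frac a pf - frac b pg = frac (a * g - b * f) (pidealNM pf pg).
Proof. by rewrite -[LHS]/(add _ (opp _)) oppE addE mulNr. Qed.
Lemma fracM a f (pf : ~ pideal p f) b g (pg : ~ pideal p g) :
  frac a pf * frac b pg = frac (a * b) (pidealNM pf pg).
Proof. exact: mulE. Qed.

End LocalRing.

Definition locally_fraction (U : opens prime_ideal)
    (s : families (@id prime_ideal) local_ring U) : Prop :=
  forall p, oset U p ->
  exists (V : opens prime_ideal) (VU : V `<=` U), oset V p /\
  exists a f : R, forall q (Vq : oset V q), exists qf : ~ pideal q f,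
    s (exist _ q (VU q Vq)) = frac a qf.

Let lf1 (U : opens prime_ideal) : locally_fraction (U := U) 1.
Proof.
move=> p Up; exists U, (@subset_refl _ _); split => //; exists 1, 1 => q Uq.
by exists (@pideal1 q); rewrite -frac_one.
Qed.

Let lf_op (op : forall p, local_ring p -> local_ring p -> local_ring p)
    (num : R -> R -> R -> R -> R) (U : opens prime_ideal)
    (s t r : families (@id prime_ideal) local_ring U) :
  (forall p a f (pf : ~ pideal p f) b g (pg : ~ pideal p g),
    op p (frac a pf) (frac b pg) = frac (num a f b g) (pidealNM pf pg)) ->
  (forall j, r j = op _ (s j) (t j)) ->
  locally_fraction s -> locally_fraction t -> locally_fraction r.
Proof.
move=> opE rE hs ht p Up.
have [V [VU [Vp [a [f sE]]]]] := hs p Up.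
have [W [WU [Wp [b [g tE]]]]] := ht p Up.
exists (opensI V W), (subset_trans (@subIsetl _ V W) VU); split => //.
exists (num a f b g), (f * g) => q [Vq Wq].
have [qf {}sE] := sE q Vq; have [qg {}tE] := tE q Wq.
exists (pidealNM qf qg); rewrite rE /= -opE -sE -tE.
by congr op; [congr (s (exist _ _ _))|congr (t (exist _ _ _))].
Qed.

Let lfB (U : opens prime_ideal) s t :
  locally_fraction s -> locally_fraction t ->
  locally_fraction (U := U) (s - t).
Proof.
apply: (@lf_op (fun p x y => x - y) (fun a f b g => a * g - b * f)) => //.
by move=> *; exact: fracB.
Qed.
Let lfM (U : opens prime_ideal) s t :
  locally_fraction s -> locally_fraction t ->
  locally_fraction (U := U) (s * t).
Proof.
apply: (@lf_op (fun p x y => x * y) (fun a f b g => a * b)) => //.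
by move=> *; exact: fracM.
Qed.
Let lf_restr (U V : opens prime_ideal) (VU : V `<=` U) s :
  locally_fraction s -> locally_fraction (U := V) (family_restr VU s).
Proof.
move=> hs p Vp; have [W [WU [Wp [a [f sE]]]]] := hs p (VU p Vp).
exists (opensI W V), (@subIsetr _ W V); split=> //; exists a, f => q [Wq Vq].
have [qf {}sE] := sE q Wq; exists qf; rewrite -sE /family_restr /=.
by congr (s (exist _ _ _)).
Qed.
Let lf_local (U : opens prime_ideal)
    (s : families (@id prime_ideal) local_ring U) :
  (forall x, oset U x -> exists (V : opens prime_ideal) (VU : V `<=` U),
     oset V x /\ locally_fraction (U := V) (family_restr VU s)) ->
  locally_fraction s.
Proof.
move=> hs p Up; have [V [VU [Vp hV]]] := hs p Up.
have [W [WV [Wp [a [f sE]]]]] := hV p Vp.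
exists W, (subset_trans WV VU); split=> //; exists a, f => q Wq.
have [qf {}sE] := sE q Wq; exists qf; rewrite -sE /family_restr /=.
by congr (s (exist _ _ _)).
Qed.

Definition spec_family_data : family_data prime_ideal :=
  FamilyData lf1 lfB lfM lf_restr lf_local.

Definition Spec : ringed_space :=
  RingedSpace (family_sheaf spec_family_data).

End Spec.

(* Main.v *)
(* For commutative R the class of E in L(R) is determined by the principal open
   D(f), f the product of E, and loc(R, E) is R_f.  A prime p is sent to the
   irreducible closed set of all classes E disjoint from p; the preimage of U~
   is then the union of the D(f) with E in U.  The comorphism evaluates a
   compatible family at p by mapping loc(R, E) to R_p for any E disjoint from p,
   so that the isomorphism reduces to loc(R, E) = O(D(f)).

   Quasi-compactness of D(f) is used only in this form: an ideal that meets the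
   complement of every prime avoiding f contains a power of f.  No finite
   partition of unity is needed. *)
From HB Require Import structures.
From mathcomp Require Import all_boot all_order all_algebra finmap.
From mathcomp Require Import mathcomp_extra boolp classical_sets functions.
From mathcomp Require Import topology.
From mathcomp Require Import ring.
Require Import Defs.

Set Implicit Arguments.
Unset Strict Implicit.
Unset Printing Implicit Defensive.

Import Order.TTheory GRing.Theory.

Local Open Scope classical_set_scope.
Local Open Scope ring_scope.
Local Open Scope quotient_scope.

(** * Products of units *)

Lemma is_unit1 (T : pzRingType) : is_unit (1 : T).
Proof. by exists 1; rewrite mulr1. Qed.

Lemma is_unitM (T : pzRingType) (x y : T) :
  is_unit x -> is_unit y -> is_unit (x * y).
Proof.
move=> [x' [x'x xx']] [y' [y'y yy']]; exists (y' * x'); split.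
  by rewrite mulrA -(mulrA y') x'x mulr1.
by rewrite mulrA -(mulrA x) yy' mulr1.
Qed.

(** * Primes avoiding the powers of an element *)

Section PrimeAvoidance.
Variable R : comPzRingType.

Definition is_ideal (I : set R) : Prop :=
  [/\ I 0, forall a b, I a -> I b -> I (a + b)
    & forall r a, I a -> I (r * a)].

Lemma is_ideal_ann a : is_ideal [set c | c * a = 0].
Proof.
split=> [|b c /= bE cE|r c /= cE]; first by rewrite /= mul0r.
  by rewrite mulrDl bE cE addr0.
by rewrite -mulrA cE mulr0.
Qed.

(** By Zorn's lemma: an ideal maximal among those containing [I] and missing all powers of [f] is
    prime. *)
Lemma exists_prime_avoiding (I : set R) (f : R) : is_ideal I ->
  (forall n, ~ I (f ^+ n)) ->
  exists p : prime_ideal R, I `<=` p /\ ~ pideal p f.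
Proof.
move=> [I0 ID IM] If.
(* The union with [I] lets [P] hold of [set0], the union of the empty chain. *)
pose P (X : set R) := is_ideal (I `|` X) /\ forall n, ~ (I `|` X) (f ^+ n).
have P0 : P set0 by rewrite /P setU0.
have [F FP totF|A [[[A0 AD AM] Af] Amax]] := @Zorn_bigcup _ P.
  (* Adding [set0] to the chain puts every element of [I] into [I] joined with some member, even
     when [F] is empty. *)
  pose F' := F `|` [set set0].
  have F'P X : F' X -> P X by move=> [/FP//|->].
  have totF' : total_on F' subset.
    move=> X Y [FX|->] [FY|->]; [exact: totF|right|left|left]; exact: sub0set.
  have F'E a : (I `|` \bigcup_(X in F) X) a -> exists2 X, F' X & (I `|` X) a.
    move=> [Ia|[X FX Xa]]; [exists set0; [by right|by left]|].
    by exists X; [left|right].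
  have F'S X : F' X -> I `|` X `<=` I `|` \bigcup_(X in F) X.
    move=> [FX|->] a [Ia|//]; try by left.
    by move=> Xa; right; exists X.
  split=> [|n /F'E[X /F'P[_ Xf]]]; last exact: Xf.
  split; first by left.
    move=> a b /F'E[X F'X Xa] /F'E[Y F'Y Yb].
    have [XY|YX] := totF' X Y F'X F'Y.
      have [[_ YD _] _] := F'P Y F'Y; apply: (F'S Y F'Y); apply: YD => //.
      by case: Xa => [|/XY]; [left|right].
    have [[_ XD _] _] := F'P X F'X; apply: (F'S X F'X); apply: XD => //.
    by case: Yb => [|/YX]; [left|right].
  move=> r a /F'E[X F'X Xa]; apply: (F'S X F'X).
  by have [[_ _ XM] _] := F'P X F'X; exact: XM.
set J := I `|` A in A0 AD AM Af.
(* By maximality, the larger ideal J + Ra contains a power of [f]. *)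
have JP a : ~ J a -> exists n r j, J j /\ f ^+ n = j + r * a.
  move=> Ja; pose B := [set x | exists r j, J j /\ x = j + r * a].
  have JB : J `<=` B by move=> j Jj; exists 0, j; rewrite mul0r addr0.
  have Ba : B a by exists 1, 0; rewrite mul1r add0r.
  apply: contrapT => nf; apply: (Amax B).
    split=> [x Ax|/(_ a Ba) Aa]; first by apply: JB; right.
    by apply: Ja; right.
  have -> : P B <-> is_ideal B /\ forall n, ~ B (f ^+ n).
    by rewrite /P setUidr // => x Ix; apply: JB; left.
  split; last by move=> n [r [j [Jj E]]]; apply: nf; exists n, r, j.
  split; first exact: JB.
    move=> _ _ [r [j [Jj ->]]] [r' [j' [Jj' ->]]].
    by exists (r + r'), (j + j'); split; [exact: AD|ring].
  move=> s _ [r [j [Jj ->]]].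
  by exists (s * r), (s * j); split; [exact: AM|ring].
have J1 : ~ J 1 by exact: (Af 0%N).
have Jprime a b : J (a * b) -> J a \/ J b.
  move=> Jab; apply: contrapT => /not_orP[/JP[n [r [j [Jj fn]]]]].
  move=> /JP[m [s [k [Jk fm]]]]; apply: (Af (n + m)%N).
  rewrite exprD fn fm.
  (* Each summand on the right has a factor [j], [k] or [a * b] in [J]. *)
  have -> : (j + r * a) * (k + s * b) =
      (k + s * b) * j + (r * a * k + (r * s) * (a * b)) by ring.
  by apply: (AD); [exact: AM|apply: (AD); exact: AM].
exists (PrimeIdeal A0 AD AM J1 Jprime); split=> [a|]; first by left.
exact: (Af 1%N).
Qed.

(** The local-to-global device used throughout: [I] consists of the elements for which a property
    holds, and it is enough to find one of them outside each prime of D(f). *)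
Lemma ideal_has_power (I : set R) (f : R) : is_ideal I ->
  (forall p : prime_ideal R, ~ pideal p f -> exists2 c, I c & ~ pideal p c) ->
  exists n, I (f ^+ n).
Proof.
move=> idI If; apply: contrapT => /forallNP/(exists_prime_avoiding idI).
by move=> [p [Ip /If[c /Ip]]].
Qed.

End PrimeAvoidance.

Lemma pidealNX (R : comPzRingType) (p : prime_ideal R) a n :
  ~ pideal p a -> ~ pideal p (a ^+ n).
Proof.
move=> pa; elim: n => [|n IHn]; first exact: pideal1.
by rewrite exprS; exact: pidealNM.
Qed.

(** * The canonical map from R to its local rings *)

Section ToLocal.
Variables (R : comPzRingType) (p : prime_ideal R).

Definition to_local (a : R) : local_ring p := frac a (@pideal1 R p).

Let to_localB : zmod_morphism to_local.
Proof.
move=> a b; rewrite /to_local fracB; apply/frac_eqP.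
by exists 1; [exact: pideal1|ring].
Qed.
Let to_localM : monoid_morphism to_local.
Proof.
split=> // a b; rewrite /to_local fracM; apply/frac_eqP.
by exists 1; [exact: pideal1|ring].
Qed.
HB.instance Definition _ := GRing.isZmodMorphism.Build _ _ to_local to_localB.
HB.instance Definition _ :=
  GRing.isMonoidMorphism.Build _ _ to_local to_localM.

Lemma to_local_eq0 a : to_local a = 0 <-> exists2 u, ~ pideal p u & u * a = 0.
Proof.
by split=> [/frac_eqP|] [u pu E]; [|apply/frac_eqP]; exists u => //;
  rewrite -[RHS]E; ring.
Qed.

(** Trades fractions for equations between images of elements of [R]. *)
Lemma fracE a f (pf : ~ pideal p f) (x : local_ring p) :
  x = frac a pf <-> x * to_local f = to_local a.
Proof.
have [b [g [pg ->]]] := frac_surj x.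
rewrite /to_local fracM; split=> /frac_eqP[u pu E]; apply/frac_eqP;
  by exists u => //; rewrite -E; ring.
Qed.

Lemma to_local_unit f : is_unit (to_local f) <-> ~ pideal p f.
Proof.
split=> [[x [xf _]] pf|pf].
  have [b [g [pg xE]]] := frac_surj x; move: xf.
  rewrite xE /to_local frac_one fracM => /frac_eqP[u pu E].
  (* A left inverse b/g of [f] gives u(bf - g) = 0 with [u] outside [p], so [f] in [p] would put
     [u * g] in [p]. *)
  have [//|//] : pideal p u \/ pideal p g.
  apply: pideal_prime; have -> : u * g = (u * b) * f.
    by apply/eqP; rewrite -subr_eq0 -oppr_eq0 -E; apply/eqP; ring.
  exact: pidealM.
have /fracE := erefl (frac 1 pf); rewrite rmorph1 => E.
by exists (frac 1 pf); split; rewrite // mulrC.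
Qed.

Lemma to_local_mulI f (x y : local_ring p) : ~ pideal p f ->
  x * to_local f = y * to_local f -> x = y.
Proof.
move=> /to_local_unit[g [_ fg]] /(congr1 ( *%R^~ g)).
by rewrite -!mulrA fg !mulr1.
Qed.

End ToLocal.

(** * Localizations at finite sets and their germs at primes *)

Section Germ.
Variable R : comPzRingType.
Implicit Types (p : prime_ideal R) (A B : set R) (E F : {fset R}).

Definition avoids p A : Prop := forall a, A a -> ~ pideal p a.

Lemma avoids_to_local_unit p A : avoids p A ->
  forall a, A a -> is_unit (to_local p a).
Proof. by move=> pA a /pA/to_local_unit. Qed.

Definition germ p A (pA : avoids p A) : {rmorphism loc A -> local_ring p} :=
  sval (cid (loc_universal (avoids_to_local_unit pA))).

Lemma germ_alpha p A (pA : avoids p A) r :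
  germ pA (alpha A r) = to_local p r.
Proof. by rewrite /germ; case: cid => h [hE _] /=. Qed.

Lemma germ_loc_map p A B (AB : preceq A B) (pA : avoids p A)
  (pB : avoids p B) x : germ pB (loc_map AB x) = germ pA x.
Proof.
apply: (@loc_rmorph_ext _ _ _ (germ pB \o loc_map AB : {rmorphism _ -> _})).
by move=> r /=; rewrite loc_mapE !germ_alpha.
Qed.

(** [germ] preserves units, and an element of [R] becomes a unit in the local ring only outside
    [p]. *)
Lemma avoids_preceq p A B : preceq A B -> avoids p B -> avoids p A.
Proof.
move=> AB pB a /AB/(is_unit_rmorph (germ pB)).
by rewrite germ_alpha => /to_local_unit.
Qed.

Lemma preceq_fsetUl E F : preceq [set` E] [set` (E `|` F)%fset].
Proof. by apply: preceq_sub => a /= aE; rewrite inE aE. Qed.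

Lemma preceq_fsetUr E F : preceq [set` F] [set` (E `|` F)%fset].
Proof. by apply: preceq_sub => a /= aF; rewrite inE aF orbT. Qed.

Lemma avoids_fsetU p E F : avoids p [set` E] -> avoids p [set` F] ->
  avoids p [set` (E `|` F)%fset].
Proof. by move=> pE pF a /=; rewrite inE => /orP[/pE|/pF]. Qed.

Definition fprod E : R := \prod_(a <- E) a.

Lemma fprod_factor E a : a \in E -> exists c, fprod E = a * c.
Proof. by move=> aE; rewrite /fprod (big_rem a aE) /=; eexists. Qed.

Lemma avoids_fprod p E : avoids p [set` E] <-> ~ pideal p (fprod E).
Proof.
split=> [pE|nE a /= /fprod_factor[c fE] pa]; last first.
  by apply: nE; rewrite fE mulrC; exact: pidealM.
rewrite /fprod big_seq; elim/big_ind: _ => [|x y|a /pE//].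
- exact: pideal1.
- exact: pidealNM.
Qed.

Lemma fprodX_unit E n : is_unit (alpha [set` E] (fprod E ^+ n)).
Proof.
elim: n => [|n IHn]; first by rewrite rmorph1; exact: is_unit1.
rewrite exprS rmorphM; apply: is_unitM IHn.
rewrite /fprod rmorph_prod big_seq; elim/big_ind: _ => [|x y|a aE].
- exact: is_unit1.
- exact: is_unitM.
- exact: alpha_unit.
Qed.

Lemma loc_mulIX E n (x y : loc [set` E]) :
  x * alpha _ (fprod E ^+ n) = y * alpha _ (fprod E ^+ n) -> x = y.
Proof.
have [g [_ fg]] := fprodX_unit E n.
by move=> /(congr1 ( *%R^~ g)); rewrite -!mulrA fg !mulr1.
Qed.

(** Induction on presenting terms; a formal inverse enters only through its two defining
    equations. *)
Lemma loc_ind A (P : loc A -> Prop) :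
  (forall r, P (alpha A r)) ->
  (forall a x, A a -> x * alpha A a = 1 -> alpha A a * x = 1 -> P x) ->
  (forall x, P x -> P (- x)) ->
  (forall x y, P x -> P y -> P (x + y)) ->
  (forall x y, P x -> P y -> P (x * y)) ->
  forall x, P x.
Proof.
move=> Pc Pi PN PD PM; elim/quotW; elim=> [r|a Aa|x Px|x Px y Py|x Px y Py].
- exact: Pc.
- apply: (Pi a) => //.
    (* Operations on [loc A] act on chosen representatives; the congruence rules of [loc_eq] replace
       these by the given terms. *)
    rewrite [LHS](_ : _ = \pi_(loc A) (LMul (LInv Aa) (LConst A a))).
      by apply/loc_piP; exact: loc_invl.
    by apply/loc_piP/loc_mul; apply/loc_piP; rewrite reprK.
  rewrite [LHS](_ : _ = \pi_(loc A) (LMul (LConst A a) (LInv Aa))).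
    by apply/loc_piP; exact: loc_invr.
  by apply/loc_piP/loc_mul; apply/loc_piP; rewrite reprK.
- rewrite (_ : \pi_(loc A) _ = - \pi_(loc A) x); first exact: PN.
  by apply/loc_piP/loc_opp; apply/loc_piP; rewrite reprK.
- rewrite (_ : \pi_(loc A) _ = \pi_(loc A) x + \pi_(loc A) y); first exact: PD.
  by apply/loc_piP/loc_add; apply/loc_piP; rewrite reprK.
- rewrite (_ : \pi_(loc A) _ = \pi_(loc A) x * \pi_(loc A) y); first exact: PM.
  by apply/loc_piP/loc_mul; apply/loc_piP; rewrite reprK.
Qed.

(** For x inverse to a, commutativity of [R] gives xr = xrax = xarx = rx. *)
Lemma alpha_comm A (x : loc A) r : x * alpha A r = alpha A r * x.
Proof.
elim/loc_ind: x => [s|a x _ xa ax|x IH|x y IHx IHy|x y IHx IHy].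
- by rewrite -!rmorphM mulrC.
- rewrite -[LHS]mulr1 -ax mulrA -(mulrA x) -rmorphM mulrC rmorphM.
  by rewrite mulrA xa mul1r.
- by rewrite mulNr mulrN IH.
- by rewrite mulrDl mulrDr IHx IHy.
- by rewrite -mulrA IHy mulrA IHx mulrA.
Qed.

(** The inverse of [a] in [E] has as numerator the cofactor of [a] in [fprod E]; exponents add under
    sums and products. *)
Lemma loc_fraction E (x : loc [set` E]) :
  exists n a, x * alpha _ (fprod E ^+ n) = alpha _ a.
Proof.
elim/loc_ind: x => [r|a x aE xa _|x|x y|x y].
- by exists 0%N, r; rewrite rmorph1 mulr1.
- have [c fE] := fprod_factor aE; exists 1%N, c.
  by rewrite expr1 fE rmorphM mulrA xa mul1r.
- by move=> [n [a xE]]; exists n, (- a); rewrite mulNr rmorphN xE.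
- move=> [n [a xE]] [m [b yE]].
  exists (n + m)%N, (a * fprod E ^+ m + b * fprod E ^+ n).
  rewrite rmorphD !(rmorphM (alpha _)) /= -xE -yE -!mulrA -!rmorphM mulrDl.
  by rewrite -!exprD (addnC m).
- move=> [n [a xE]] [m [b yE]]; exists (n + m)%N, (a * b).
  rewrite rmorphM /= -xE -yE exprD rmorphM !mulrA; congr (_ * _).
  by rewrite -!mulrA alpha_comm.
Qed.

(** Clearing denominators turns x - y into some [a] from [R] that vanishes at all primes avoiding
    [E]. The annihilator of [a] then contains a power of [fprod E], which is a unit in [loc]. *)
Lemma germ_inj E (x y : loc [set` E]) :
  (forall p (pE : avoids p [set` E]), germ pE x = germ pE y) -> x = y.
Proof.
move=> xy; apply/eqP; rewrite -subr_eq0; apply/eqP.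
have [n [a dE]] := loc_fraction (x - y).
have [p pf|m fa] := ideal_has_power (f := fprod E) (is_ideal_ann a).
  have pE : avoids p [set` E] by exact/avoids_fprod.
  have /to_local_eq0[u pu ua] : to_local p a = 0.
    by rewrite -(germ_alpha pE) -dE rmorphM rmorphB xy subrr mul0r.
  by exists u.
apply: (@loc_mulIX E (n + m)).
rewrite mul0r exprD rmorphM mulrA dE -rmorphM mulrC.
by rewrite (_ : _ * a = 0) // rmorph0.
Qed.

End Germ.

(** * Sections of the structure sheaf of Spec over principal open sets *)

Section SpecSections.
Variables (R : comPzRingType) (V : opens (prime_ideal R)).
Variable t : families (@id (prime_ideal R)) (@local_ring R) V.
Hypothesis t_frac : locally_fraction t.
Variable E : {fset R}.
Hypothesis EV : forall p : prime_ideal R, avoids p [set` E] -> oset V p.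

Let t_at (p : prime_ideal R) (Vp : oset V p) : local_ring p := t (exist _ p Vp).

Let is_quotient (h b : R) : Prop := forall q : prime_ideal R, ~ pideal q h ->
  oset V q /\ forall Vq : oset V q, t_at Vq * to_local q h = to_local q b.

(** Near [p] the section is a/g; extending this by an [h] with D(h) inside the neighbourhood gives
    ha/hg, whose denominator itself cuts out the open set D(hg). *)
Let local_quotient (p : prime_ideal R) : oset V p ->
  exists h b, ~ pideal p h /\ is_quotient h b.
Proof.
move=> Vp; have [W [WV [Wp [a [g tE]]]]] := t_frac Vp.
have [A WA] := oset_open W; move: Wp (Wp); rewrite {1}WA.
move=> /existsNP[h /not_implyP[Ah ph]] Wp.
have [pg _] := tE p Wp.
exists (h * g), (h * a); split; first exact: pidealNM.
move=> q qhg; have Wq : oset W q.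
  rewrite WA => /(_ h Ah) qh; apply: qhg.
  by rewrite mulrC; exact: pidealM.
split=> [|Vq]; first exact: (WV).
have [qg /fracE /= {}tE] := tE q Wq.
rewrite (Prop_irrelevance Vq (WV q Wq)) !rmorphM /= -tE.
by rewrite mulrCA.
Qed.

(* [t h - b] vanishes on D(h), hence is killed by one power of [h] on D(E). *)
Let quotient_power h b : is_quotient h b ->
  exists n, forall (p : prime_ideal R) (Vp : oset V p), avoids p [set` E] ->
    t_at Vp * to_local p (h ^+ n.+1) = to_local p (b * h ^+ n).
Proof.
move=> hb.
(* The [c] over whose D(c) one exponent suffices. They form an ideal: a prime missing c + d misses
   [c] or [d], and exponents may be raised ([Kmono]). *)
pose K := [set c : R | exists n, forall (p : prime_ideal R) (Vp : oset V p),
  ~ pideal p c -> t_at Vp * to_local p (h ^+ n.+1) = to_local p (b * h ^+ n)].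
have Kmono (p : prime_ideal R) (Vp : oset V p) n m :
    t_at Vp * to_local p (h ^+ n.+1) = to_local p (b * h ^+ n) ->
    t_at Vp * to_local p (h ^+ (n + m).+1) = to_local p (b * h ^+ (n + m)).
  rewrite -addSn !exprD mulrA => tE.
  by rewrite (rmorphM _ (h ^+ n.+1)) (rmorphM _ (b * _)) /= mulrA tE.
have idK : is_ideal K.
  split=> [|c d [n cE] [m dE]|r c [n cE]].
  - by exists 0%N => p Vp; case; exact: pideal0.
  - exists (n + m)%N => p Vp pcd.
    have [pc|pc] := pselect (pideal p c); last by apply: Kmono; exact: cE.
    rewrite addnC; apply: Kmono; apply: dE => pd.
    by apply: pcd; exact: pidealD.
  - exists n => p Vp prc; apply: cE => pc; apply: prc; exact: pidealM.
have [p|N [n fE]] := ideal_has_power (f := fprod E) idK.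
  move=> /avoids_fprod/EV/local_quotient[k [d [pk kd]]]; exists k => //.
  (* On D(hk) the quotients b/h and d/k agree, so a power of [h * k] kills [b * k - d * h]; this
     places [k] in [K]. *)
  have annI := is_ideal_ann (b * k - d * h).
  have [q qhk|n nE] := ideal_has_power (f := h * k) annI.
    have qh : ~ pideal q h.
      by move=> qh; apply: qhk; rewrite mulrC; exact: pidealM.
    have qk : ~ pideal q k by move=> qk; apply: qhk; exact: pidealM.
    have [Vq bE] := hb q qh; have [_ dE] := kd q qk.
    have /to_local_eq0[u qu uE] : to_local q (b * k - d * h) = 0.
      rewrite rmorphB !rmorphM /= -(bE Vq) -(dE Vq) -!mulrA.
      by rewrite (mulrC (to_local q k)) subrr.
    by exists u.
  exists n => q Vq qk; have [_ dE] := kd q qk.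
  (* After multiplication by [k ^+ n.+1] the two sides differ, up to sign, by
     [(h * k) ^+ n * (b * k - d * h)]. *)
  apply: (to_local_mulI (pidealNX (n := n.+1) qk)).
  rewrite -mulrA -rmorphM (exprS k) mulrCA rmorphM mulrA dE.
  apply/eqP; rewrite -!rmorphM -subr_eq0 -rmorphB.
  rewrite (_ : _ - _ = - ((h * k) ^+ n * (b * k - d * h))).
    by rewrite [_ * (_ - _)]nE oppr0 rmorph0.
  by rewrite exprMn !exprS; ring.
by exists n => p Vp /avoids_fprod pE; apply: fE; exact: pidealNX.
Qed.

(** The [c] for which c times the section comes from a single element of [R] over D(E) form an
    ideal. By [quotient_power] it contains a power of each local denominator, hence a power of
    [fprod E]. *)
Lemma locally_fraction_germ : exists x : loc [set` E],
  forall (p : prime_ideal R) (Vp : oset V p) (pE : avoids p [set` E]),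
  t (exist _ p Vp) = germ pE x.
Proof.
have idI : is_ideal [set c | exists a,
    forall (p : prime_ideal R) (Vp : oset V p), avoids p [set` E] ->
    t_at Vp * to_local p c = to_local p a].
  split=> [|c d [a aE] [b bE]|r c [a aE]].
  - by exists 0 => p Vp _; rewrite rmorph0 mulr0.
  - by exists (a + b) => p Vp pE; rewrite !rmorphD mulrDr aE ?bE.
  - by exists (r * a) => p Vp pE; rewrite !rmorphM /= mulrCA aE.
have [p|N [a aE]] := ideal_has_power (f := fprod E) idI.
  move=> /avoids_fprod/EV/local_quotient[h [b [ph /quotient_power[n nE]]]].
  by exists (h ^+ n.+1); [exists (b * h ^+ n)|exact: pidealNX].
have [g [gf _]] := fprodX_unit E N.
exists (alpha _ a * g) => p Vp pE; apply: (@to_local_mulI _ _ (fprod E ^+ N)).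
  by apply: pidealNX; exact/avoids_fprod.
by rewrite -/(t_at Vp) aE // -!(germ_alpha pE) -rmorphM -mulrA gf mulr1.
Qed.

End SpecSections.

(** * Bijective homomorphisms of presheaves *)

Section SheafIso.
Variables (X : topologicalType) (F G : presheaf X) (f : sheaf_hom F G).

(** That the inverses respect ring operations and restrictions can be tested after applying the
    injective [f]. *)
Lemma sheaf_iso_of_bijective : (forall U, injective (f U)) ->
  (forall U t, exists s, f U s = t) -> is_sheaf_iso f.
Proof.
move=> inj surj; pose g U (t : G U) : F U := sval (cid (surj U t)).
have fK U : cancel (g U) (f U) by move=> t; exact: svalP (cid (surj U t)).
have gB U : zmod_morphism (g U).
  by move=> s t; apply: inj; rewrite rmorphB !fK.
have gM U : monoid_morphism (g U).
  by split=> [|s t]; apply: inj; rewrite ?rmorph1 ?rmorphM !fK.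
pose mB U := GRing.isZmodMorphism.Build _ _ (g U) (gB U).
pose mM U := GRing.isMonoidMorphism.Build _ _ (g U) (gM U).
pose gr U : {rmorphism G U -> F U} := HB.pack (g U) (mB U) (mM U).
have gr_restr (U V : opens X) (VU : V `<=` U) (s : G U) :
    gr V (restr G VU s) = restr F VU (gr U s).
  by apply: inj; rewrite hom_restr /= !fK.
exists (SheafHom gr_restr); split=> U s; last exact: fK.
by apply: inj; exact: fK.
Qed.

End SheafIso.

(** * Componentwise operations on sections *)

Section FamilyOperations.
Variables (X : topologicalType) (D : family_data X) (U : opens X).
Implicit Types s t : family_section D U.

Lemma fam_val1 j : fam_val (1 : family_section D U) j = 1.
Proof. by []. Qed.

Lemma fam_valB s t j : fam_val (s - t) j = fam_val s j - fam_val t j.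
Proof. by []. Qed.

Lemma fam_valM s t j : fam_val (s * t) j = fam_val s j * fam_val t j.
Proof. by []. Qed.

End FamilyOperations.

(** * The embedding of Spec into NCSpec *)

Section SpecToNCSpec.
Variable R : comPzRingType.
Local Notation L := (alexandrov (locposet R)).
Implicit Types (p : prime_ideal R) (E F : {fset R}).

Definition avoiding_classes p : set L :=
  [set x | exists2 E, x = locclass E & avoids p [set` E]].

Lemma avoiding_classesE p E :
  avoiding_classes p (locclass E) <-> avoids p [set` E].
Proof.
split=> [[F EF]|pE]; last by exists E.
apply: avoids_preceq; apply/locclass_le; rewrite EF; exact: lexx.
Qed.

Lemma avoiding_classes_closed p : closed (avoiding_classes p).
Proof.
rewrite -openC open_alexandrov => x y + xy; apply: contra_not.
move: xy; elim/quotW: x => E; elim/quotW: y => F EF.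
move=> /avoiding_classesE pF; apply/avoiding_classesE.
by apply: avoids_preceq pF; exact/locclass_le.
Qed.

(** The set is directed: if [p] avoids [E] and [F], it avoids their union, whose class lies above
    both. *)
Lemma avoiding_classes_irreducible p : irreducible (avoiding_classes p).
Proof.
split; first by exists (locclass fset0), fset0.
move=> A B cA cB AB; apply: contrapT => /not_orP[nA nB]; move: nA nB.
move=> /existsNP[_ /not_implyP[[E -> pE] nAE]].
move=> /existsNP[_ /not_implyP[[F -> pF] nBF]].
have := closed_openC cA; have := closed_openC cB.
rewrite !open_alexandrov => uB uA.
have EU : (locclass E <= locclass (E `|` F)%fset)%O.
  exact/locclass_le/preceq_fsetUl.
have FU : (locclass F <= locclass (E `|` F)%fset)%O.
  exact/locclass_le/preceq_fsetUr.
have pEF : avoiding_classes p (locclass (E `|` F)%fset).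
  by apply/avoiding_classesE; exact: avoids_fsetU.
by have [/(uA _ _ nAE EU)|/(uB _ _ nBF FU)] := AB _ pEF.
Qed.

Definition spec_to_ncspec p : soberification L :=
  Soberification (avoiding_classes_closed (p := p))
    (avoiding_classes_irreducible p).

(** The preimage of [W] under [sob_eta] is the open set of L(R) that [W] corresponds to, and the one
    carrying its sections. *)
Lemma spec_to_ncspecP (W : opens (soberification L)) p :
  oset W (spec_to_ncspec p) <->
  exists2 E, avoids p [set` E] & oset W (sob_eta (locclass E : L)).
Proof.
have [U oU WU] := oset_open W.
have WE (x : L) : oset W (sob_eta x) <-> U x.
  by rewrite WU -[_ (sob_eta x)]/((@sob_eta L @^-1` _) x) sob_eta_tilde.
rewrite {1}WU; split=> [[_ [[E -> pE] UE]]|[E pE /WE UE]]; last first.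
  by exists (locclass E); split=> //; exact/avoiding_classesE.
by exists E => //; exact/WE.
Qed.

Lemma spec_to_ncspec_continuous : continuous spec_to_ncspec.
Proof.
apply/continuousP => W oW; pose W' := Opens oW.
exists [set f | exists2 E, f = fprod E & W (sob_eta (locclass E : L))].
apply/seteqP; split=> p.
  move=> /(spec_to_ncspecP W')[E /avoids_fprod pE WE] z.
  by apply: pE; apply: z; exists E.
move=> z; apply/(spec_to_ncspecP W'); apply: contrapT => nE; apply: z.
move=> _ [E -> WE]; apply: contrapT => /avoids_fprod pE.
by apply: nE; exists E.
Qed.

(** Singletons recover [p]: the class of {a} is avoided exactly when [a] lies outside [p]. *)
Lemma spec_to_ncspec_inj : injective spec_to_ncspec.
Proof.
suff sub p q : spec_to_ncspec p = spec_to_ncspec q -> q `<=` p.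
  move=> p q pq; have : pideal p = pideal q.
    by apply/seteqP; split; exact: sub.
  case: p q {pq} => [I a b c d e] [J a' b' c' d' e'] /= IJ.
  by case: _ / IJ a' b' c' d' e' => *; congr PrimeIdeal;
    exact: Prop_irrelevance.
move=> pq a qa; apply: contrapT => pa.
have : avoiding_classes p (locclass [fset a]%fset).
  by apply/avoiding_classesE => b /=; rewrite inE => /eqP ->.
rewrite -[avoiding_classes p]/(sob_set (spec_to_ncspec p)) pq.
by move=> /avoiding_classesE/(_ a); apply=> //=; rewrite inE.
Qed.

(** D(a) is cut out by the upper set of classes above that of {a}. With continuity, Spec thus
    carries the induced topology. *)
Lemma spec_open_preimage (V : set (prime_ideal R)) : open V ->
  exists2 W : set (soberification L), open W & V = spec_to_ncspec @^-1` W.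
Proof.
move=> [A ->].
pose U : set L := [set x | exists2 a, A a & (locclass [fset a]%fset <= x)%O].
have oU : open U.
  rewrite open_alexandrov => x y [a Aa ax] xy.
  by exists a => //; exact: le_trans xy.
exists (sob_tilde U); first by exists U.
apply/seteqP; split=> p.
  move=> /existsNP[a /not_implyP[Aa pa]].
  exists (locclass [fset a]%fset); split; last by exists a => //; exact: lexx.
  by apply/avoiding_classesE => b /=; rewrite inE => /eqP ->.
move=> [_ [[E -> pE] [a Aa /locclass_le/avoids_preceq/(_ pE) pa]]] z.
by apply: (pa a) => /=; [rewrite inE|exact: z].
Qed.

Lemma avoids_in_preimage (W : opens (soberification L)) E p :
  oset W (sob_eta (locclass E : L)) -> avoids p [set` E] ->
  oset (opens_preimage spec_to_ncspec_continuous W) p.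
Proof. by move=> WE pE; apply/spec_to_ncspecP; exists E. Qed.

(** * The comorphism and its bijectivity *)

Section Comorphism.
Variable W : opens (soberification L).
Local Notation U := (opens_preimage (@sob_eta_continuous L) W).
Local Notation V := (opens_preimage spec_to_ncspec_continuous W).
Local Notation OU := (loc_sheaf R U).
Local Notation OV := (rs_sheaf (Spec R) V).

(** Both germs agree with the one taken at the union of [E] and [F], by compatibility of the
    family. *)
Lemma germ_independent (s : OU) p E F (UE : oset U (locclass E))
    (UF : oset U (locclass F)) (pE : avoids p [set` E])
    (pF : avoids p [set` F]) :
  germ pE (fam_val s (exist _ E UE)) = germ pF (fam_val s (exist _ F UF)).
Proof.
have UEF : oset U (locclass (E `|` F)%fset).
  have := oset_open U; rewrite open_alexandrov; apply; first exact: UE.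
  exact/locclass_le/preceq_fsetUl.
have pEF := avoids_fsetU pE pF.
rewrite -(germ_loc_map (@preceq_fsetUl R E F) pE pEF).
rewrite -(germ_loc_map (@preceq_fsetUr R E F) pF pEF).
by rewrite !(asboolW (fam_cond s)).
Qed.

(** An arbitrary choice of finite set at each prime; [germsE] removes the dependence on it. *)
Let index (j : {p | oset V p}) :
  {E | avoids (sval j) [set` E] /\ oset U (locclass E)}.
Proof.
by apply: cid; have /spec_to_ncspecP[E pE UE] := svalP j; exists E.
Qed.

Definition germs (s : OU) : families (@id (prime_ideal R)) (@local_ring R) V :=
  fun j => germ (svalP (index j)).1
    (fam_val s (exist _ (sval (index j)) (svalP (index j)).2)).

Lemma germsE (s : OU) p (Vp : oset V p) E (UE : oset U (locclass E))
    (pE : avoids p [set` E]) :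
  germs s (exist _ p Vp) = germ pE (fam_val s (exist _ E UE)).
Proof. exact: germ_independent. Qed.

(** Over D([fprod E]) all values are germs of one element of [loc], a fraction by [loc_fraction]. *)
Lemma germs_locally_fraction (s : OU) : locally_fraction (germs s).
Proof.
move=> p Vp; have /spec_to_ncspecP[E pE UE] := Vp.
pose D : set (prime_ideal R) := ~` zeros [set fprod E].
have oD : open D by exists [set fprod E].
have DE q : D q <-> avoids q [set` E].
  by rewrite avoids_fprod /D /zeros /= sub1set inE.
have DV : Opens oD `<=` V.
  by move=> q /DE qE; exact: avoids_in_preimage UE qE.
exists (Opens oD), DV; split; first exact/DE.
have [n [a sE]] := loc_fraction (fam_val s (exist _ E UE)).
exists a, (fprod E ^+ n) => q Dq; have qE := (DE q).1 Dq.
have qf : ~ pideal q (fprod E ^+ n) by apply: pidealNX; exact/avoids_fprod.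
exists qf; apply/fracE; rewrite (germsE _ _ UE qE).
by rewrite -!(germ_alpha qE) -rmorphM sE.
Qed.

Definition comorphism_at (s : OU) : OV :=
  FamilySection (D := spec_family_data R) (asboolT (germs_locally_fraction s)).

Let comorphismB : zmod_morphism comorphism_at.
Proof.
move=> s t; apply: family_section_ext => j.
by rewrite fam_valB /= /germs fam_valB rmorphB.
Qed.
Let comorphismM : monoid_morphism comorphism_at.
Proof.
split=> [|s t]; apply: family_section_ext => j.
  by rewrite fam_val1 /= /germs fam_val1 rmorph1.
by rewrite fam_valM /= /germs fam_valM rmorphM.
Qed.
HB.instance Definition _ :=
  GRing.isZmodMorphism.Build _ _ comorphism_at comorphismB.
HB.instance Definition _ :=
  GRing.isMonoidMorphism.Build _ _ comorphism_at comorphismM.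

Lemma comorphism_at_inj : injective comorphism_at.
Proof.
move=> s t st; apply: family_section_ext => -[E UE].
apply: germ_inj => p pE.
have Vp := avoids_in_preimage UE pE.
have := congr1 (fun r : OV => fam_val r (exist _ p Vp)) st.
by rewrite /= !(germsE _ _ UE pE).
Qed.

(** [locally_fraction_germ] supplies a component for each [E], and [germ_inj] makes the components
    compatible. *)
Lemma comorphism_at_surj (t : OV) : exists s, comorphism_at s = t.
Proof.
have tP : locally_fraction (fam_val t) by exact: asboolW (fam_cond t).
have xP (j : {E | oset U (locclass E)}) : {x : loc [set` sval j] |
    forall p (Vp : oset V p) (pE : avoids p [set` sval j]),
    fam_val t (exist _ p Vp) = germ pE x}.
  apply/cid/(locally_fraction_germ tP) => p.
  exact: avoids_in_preimage (svalP j).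
pose x : families (fd_base (loc_family_data R)) (fd_fiber (loc_family_data R))
  U := fun j => sval (xP j).
have xE E (UE : oset U (locclass E)) p (Vp : oset V p)
    (pE : avoids p [set` E]) :
    fam_val t (exist _ p Vp) = germ pE (x (exist _ E UE)).
  exact: (svalP (xP (exist _ E UE))).
have xC : fd_cond x.
  move=> E F UE UF EF; apply: germ_inj => p pF.
  have Vp := avoids_in_preimage UF pF.
  by rewrite (germ_loc_map _ (avoids_preceq EF pF)) -!(xE _ _ p Vp).
exists (FamilySection (asboolT xC)); apply: family_section_ext => -[p Vp].
have /spec_to_ncspecP[E pE UE] := Vp.
by rewrite /= (germsE _ _ UE pE) /= (xE E UE p Vp pE).
Qed.

End Comorphism.


Lemma comorphism_at_restr (W W' : opens (soberification L)) (WW : W' `<=` W)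
    (s : rs_sheaf (NCSpec R) W) :
  comorphism_at (restr (rs_sheaf (NCSpec R)) WW s) =
  restr (pushforward spec_to_ncspec_continuous (rs_sheaf (Spec R))) WW
    (comorphism_at s).
Proof.
apply: family_section_ext => -[p Vp].
have /spec_to_ncspecP[E pE UE] := Vp.
rewrite /= /family_restr /= (germsE _ _ UE pE) (germsE _ _ (WW _ UE) pE) /=.
exact: germ_independent.
Qed.

Definition spec_morphism : rs_morphism (Spec R) (NCSpec R) :=
  @RSMorphism (Spec R) (NCSpec R) spec_to_ncspec spec_to_ncspec_continuous
    (@SheafHom _ (rs_sheaf (NCSpec R))
      (pushforward spec_to_ncspec_continuous (rs_sheaf (Spec R)))
      (fun W => @comorphism_at W : {rmorphism loc_sheaf R _ ->
        rs_sheaf (Spec R) (opens_preimage spec_to_ncspec_continuous W)})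
      comorphism_at_restr).

Lemma spec_morphism_iso : is_sheaf_iso (rs_comorphism spec_morphism).
Proof.
apply: sheaf_iso_of_bijective => U; first exact: comorphism_at_inj.
exact: comorphism_at_surj.
Qed.

(** * Position of the image relative to the generic point *)

Lemma spec_to_ncspec_neq_generic p :
  (~` [set NCSpec_generic R]) (spec_to_ncspec p : NCSpec R).
Proof.
(* The generic point contains the class of {0}, which no prime avoids. *)
move=> /= pg; have : avoiding_classes p (locclass [fset 0]%fset).
  by rewrite -[avoiding_classes p]/(sob_set (spec_to_ncspec p)) pg.
move=> /avoiding_classesE/(_ 0); apply; last exact: pideal0.
by rewrite /= inE.
Qed.

(** If no prime avoids [E], then [fprod E] is nilpotent and [loc] at [E] is zero, so the class of
    [E] is the largest. A closed set is a lower set, so [C] containing this class would be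
    generic. *)
Lemma spec_to_ncspec_dense (W : set (NCSpec R)) (C : NCSpec R) :
  open W -> W C -> C <> NCSpec_generic R -> exists p, W (spec_to_ncspec p).
Proof.
move=> [U oU ->] [x [Cx Ux]] Cg; elim/quotW: x => E in Cx Ux.
apply: contrapT => npE; apply: Cg.
have id0 : is_ideal [set 0 : R].
  by split=> [//|a b -> ->|r a ->] /=; rewrite ?addr0 ?mulr0.
have [p /avoids_fprod pE|n fE] := ideal_has_power (f := fprod E) id0.
  exfalso; apply: npE; exists p; exists (locclass E).
  by split=> //; exact/avoiding_classesE.
have [g [g0 _]] := fprodX_unit E n.
have EF F : preceq [set` F] [set` E].
  (* In the zero ring every element has inverse 0. *)
  move=> a _; exists 0; rewrite mul0r mulr0 -g0 (_ : _ ^+ n = 0) //.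
  by rewrite rmorph0 mulr0.
apply: soberification_ext; apply/seteqP; split=> // x _ /=.
elim/quotW: x => F; apply: contrapT => nCF.
have := closed_openC (@sob_closed L C); rewrite open_alexandrov.
move=> /(_ (locclass F) (locclass E) nCF); apply=> //.
exact/locclass_le.
Qed.

End SpecToNCSpec.

Theorem theorem8p5 (R : comPzRingType) :
  exists phi : rs_morphism (Spec R) (NCSpec R),
    (exists (D : set (~` [set NCSpec_generic R])) (h : Spec R -> D),
       [/\ dense D,
           is_homeomorphism (X := Spec R) (Y := D) h
         & forall p, rs_map phi p = set_val (set_val (h p))]) /\
    is_sheaf_iso (rs_comorphism phi).
Proof.
exists (spec_morphism R); split; last exact: spec_morphism_iso.
pose e (p : Spec R) : (~` [set NCSpec_generic R]) :=
  exist _ (spec_to_ncspec p : NCSpec R)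
    (mem_set (@spec_to_ncspec_neq_generic R p)).
pose D := range e.
pose h (p : Spec R) : D := exist _ (e p) (mem_set (imageT e p)).
exists D, h; split=> //.
- move=> _ /[swap] -[W oW <-] [[C Cg] /= WC].
  have [p Wp] := spec_to_ncspec_dense oW WC (set_mem Cg).
  by exists (e p); split=> //; exists p.
- pose g (x : D) : Spec R := sval (cid2 (set_mem (valP x))).
  have hg : cancel g h.
    by move=> x; apply/val_inj; rewrite /= /g; case: cid2.
  have h_inj : injective h.
    move=> p q /(congr1 (fun x : D => set_val (set_val x))).
    exact: spec_to_ncspec_inj.
  have gh : cancel h g by move=> p; apply: h_inj; exact: hg.
  split; last (exists g; split=> //).
    apply/continuousP => _ [_ [W oW <-] <-].
    exact: (open_preimage (@spec_to_ncspec_continuous R) (Opens oW)).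
  (* Continuity of the inverse: [V] is the trace of an open [W] of NCSpec, so its preimage under [g]
     is the trace of [W] on [D]. *)
  apply/continuousP => V /spec_open_preimage[W oW VW].
  exists (set_val @^-1` W); first by exists W.
  have gE x : set_val (set_val x) = spec_to_ncspec (g x) by rewrite -{1}(hg x).
  by rewrite VW; apply/seteqP; split=> x /=; rewrite gE.
Qed.
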